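(* Let $n\ge1$, let $\lambda,\mu$ be partitions with at most $n$ parts with $\mu\subseteq\lambda$, and let $r=(r_1,\dots,r_n),s=(s_1,\dots,s_n)$ be sequences of positive integers such that for each $1\le i\le n-1$ with $\mu_i<\lambda_{i+1}$ we have $r_i\le r_{i+1}$ and $s_i\le s_{i+1}$. Then \[ G^{\mathrm{row}(r,s)}_{\lambda/\mu}(x;\alpha,\beta)=C\det\Big(h_{\lambda_i-\mu_j-i+j}\big[X_{[r_j,s_i]}\ominus(A_{\lambda_i}-A_{\mu_j}-B_{i-1}+B_j)\big]\Big)_{i,j=1}^n, \] where $C=\prod_{i=1}^n\prod_{l=r_i}^{s_i}(1-\beta_ix_l)$ (an empty product is $1$).
   Context: Indeterminates $x=(x_1,x_2,\dots)$, $\alpha=(\alpha_1,\dots)$, $\beta=(\beta_1,\dots)$. For $m\in\mathbb Z$, $A_m=\alpha_1+\dots+\alpha_m$ and $B_m=\beta_1+\dots+\beta_m$, with $A_m=B_m=0$ for $m\le0$; $X_{[r,s]}=x_r+\dots+x_s$, which is $0$ if $r>s$. For a formal $\mathbb Z$-linear combination $Z=\sum_v c_vv$ of finitely many indeterminates, $h_m[Z]$ is the coefficient of $t^m$ in $\prod_v(1-vt)^{-c_v}$ (so $h_m[Z]=0$ for $m<0$). For such $Y,Z$, $h_m[Y\ominus Z]=\sum_{b\ge0}h_{m+b}[Y]h_b[Z]$. Partitions with at most $n$ parts are written $(\lambda_1,\dots,\lambda_n)$ padded with zeros; the Young diagram is $\{(i,j):1\le j\le\lambda_i\}$ and $\lambda/\mu$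 is the set difference of diagrams. A marked multiset-valued tableau of shape $\lambda/\mu$ is a filling $T$ of the cells of $\lambda/\mu$ such that each $T(i,j)$ is a nonempty finite multiset $\{a_1\le\dots\le a_k\}$ of positive integers in which each $a_t$ with $t\ge2$ and $a_{t-1}<a_t$ may be marked; $\max T(i,j)\le\min T(i,j+1)$ and $\max T(i,j)<\min T(i+1,j)$ whenever the respective cells both lie in $\lambda/\mu$. Its weight is $\mathrm{wt}(T)=\prod_{(i,j)\in\lambda/\mu}x^{T(i,j)}\alpha_j^{u(i,j)-1}(-\beta_i)^{m(i,j)}$, where $x^{T(i,j)}=\prod_kx_k^{(\text{number of occurrences of }k\text{ in }T(i,j))}$ and $u(i,j)$, $m(i,j)$ are the numbers of unmarked and marked elements of $T(i,j)$. $G^{\mathrm{row}(r,s)}_{\lambda/\mu}(x;\alpha,\beta)$ is the sum of $\mathrm{wt}(T)$ over all such $T$ with $r_i\le\min T(i,j)$ and $\max T(i,j)\le s_i$ for all cells $(i,j)\in\lambda/\mu$. *)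

(* Defs.v *)
From HB Require Import structures.
From mathcomp Require Import all_boot all_order all_algebra finmap.
From mathcomp Require Import boolp classical_sets functions cardinality fsbigop.
From mathcomp.multinomials Require Import monalg.

Set Implicit Arguments.
Unset Strict Implicit.
Unset Printing Implicit Defensive.

Import Order.TTheory GRing.Theory Num.Theory.
Local Open Scope classical_set_scope.
Local Open Scope ring_scope.

(* Formal power series in the (possibly infinitely many) commuting
   indeterminates i : I, with coefficients in R: arbitrary families of
   coefficients indexed by the monomials of finite support. *)
Record fps (I : choiceType) (R : comNzRingType) : Type :=
  FPS { fpscoef : {cmonom I} -> R }.

HB.instance Definition _ (I : choiceType) (R : comNzRingType) :=
  gen_eqMixin (fps I R).
HB.instance Definition _ (I : choiceType) (R : comNzRingType) :=
  gen_choiceMixin (fps I R).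

Section FPSRing.
Variables (I : choiceType) (R : comNzRingType).
Local Notation S := (fps I R).
Implicit Types (f g h : S) (m : {cmonom I}).

Lemma fpsP f g : (forall m, fpscoef f m = fpscoef g m) -> f = g.
Proof. by case: f g => [f] [g] /= fg; congr FPS; apply/funext. Qed.

Definition fpsC (c : R) : S := FPS (fun m => if m == mone then c else 0).
Definition fpsX (i : I) : S := FPS (fun m => (m == ucm i)%:R).
Definition fps_opp f : S := FPS (fun m => - fpscoef f m).
Definition fps_add f g : S := FPS (fun m => fpscoef f m + fpscoef g m).
Definition fps_mul f g : S := FPS (fun m =>
  \sum_(p \in [set p : {cmonom I} * {cmonom I} | mmul p.1 p.2 = m])
    fpscoef f p.1 * fpscoef g p.2).

Lemma fps_addA : associative fps_add.
Proof. by move=> f g h; apply: fpsP => m /=; rewrite addrA. Qed.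
Lemma fps_addC : commutative fps_add.
Proof. by move=> f g; apply: fpsP => m /=; rewrite addrC. Qed.
Lemma fps_add0 : left_id (fpsC 0) fps_add.
Proof. by move=> f; apply: fpsP => m /=; rewrite if_same add0r. Qed.
Lemma fps_addN : left_inverse (fpsC 0) fps_opp fps_add.
Proof. by move=> f; apply: fpsP => m /=; rewrite if_same addNr. Qed.

HB.instance Definition _ :=
  GRing.isZmodule.Build S fps_addA fps_addC fps_add0 fps_addN.

Lemma cm_divisors_finite m : exists D : {fset {cmonom I}},
  forall a b : {cmonom I}, mmul a b = m -> a \in D.
Proof.
exists [fset x in [seq mkcmonom [fsfun i : finsupp m => nat_of_ord (e i) | 0%N]
  | e : {ffun finsupp m -> 'I_(mdeg m).+1}
      <- enum {: {ffun finsupp m -> 'I_(mdeg m).+1}}]]%fset.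
move=> a b abm; have le i : (a i <= m i)%N by rewrite -abm mulcmE leq_addr.
have led i : (a i <= mdeg m)%N.
  apply: leq_trans (le i) _; rewrite mdegE.
  case: (mdomP m i) => // im.
  by rewrite (big_fsetD1 i) //= leq_addr.
rewrite inE /=; apply/mapP; exists [ffun i => inord (a (val i))].
  by rewrite mem_enum.
apply/eqP/cmP => i; rewrite cmE fsfun_ffun.
case: insubP => [u _ ui|]; first by rewrite /= ffunE inordK ?ltnS ?ui.
rewrite -cmE_eq0 => /eqP mi0; have := le i.
by rewrite mi0 leqn0 => /eqP.
Qed.

Definition fps_trunc (D : {fset {cmonom I}}) f : {malg R[{cmonom I}]} :=
  [malg k in D => fpscoef f k].

Lemma fps_truncE (D : {fset {cmonom I}}) f m :
  (fps_trunc D f)@_m = if m \in D then fpscoef f m else 0.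
Proof. by rewrite mcoeffE. Qed.

Lemma msupp_trunc (D : {fset {cmonom I}}) f :
  (msupp (fps_trunc D f) `<=` D)%fset.
Proof.
apply/fsubsetP => k; rewrite -mcoeff_neq0 fps_truncE.
by case: ifP => //; rewrite eqxx.
Qed.

Definition divisor_closed (D : {fset {cmonom I}}) :=
  forall a b, mmul a b \in D -> a \in D /\ b \in D.

Lemma divisor_closed_ex m : exists2 D, divisor_closed D & m \in D.
Proof.
have [D0 mD0] := cm_divisors_finite m.
pose D := [fset a in D0 | `[< exists b, mmul a b = m >]]%fset.
have DP a : reflect (exists b, mmul a b = m) (a \in D).
  apply: (iffP idP) => [|[b ab]].
    by rewrite !inE /= => /andP[_ /asboolP].
  rewrite !inE /=; apply/andP; split; first exact: mD0 ab.
  by apply/asboolP; exists b.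
exists D; last by apply/DP; exists mone; rewrite mulm1.
move=> a b /DP[c abc]; split; apply/DP.
  by exists (mmul b c); rewrite mulmA.
by exists (mmul a c); rewrite mulmA (mulmC b).
Qed.

(* On a finite divisor-closed set of monomials, the product of series is the
   product of the truncations in the monoid algebra. *)
Lemma fps_mulE (D : {fset {cmonom I}}) f g m : divisor_closed D -> m \in D ->
  fpscoef (fps_mul f g) m = (fps_trunc D f * fps_trunc D g)@_m.
Proof.
move=> Dc mD; rewrite (mcoeffMlw _ (msupp_trunc D f) (msupp_trunc D g)) /=.
pose r := [seq (a, b) | a <- enum_fset D, b <- enum_fset D].
have rP p : (p \in r) = (p.1 \in D) && (p.2 \in D).
  apply/allpairsP/andP => [[q [q1 q2 ->]]//|[p1 p2]].
  by exists p; case: p p1 p2.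
have ur : uniq r.
  by apply: allpairs_uniq; rewrite ?fset_uniq // => -[? ?] [? ?].
pose F (p : {cmonom I} * {cmonom I}) :=
  (fpscoef f p.1 * fpscoef g p.2) *+ (mmul p.1 p.2 == m).
transitivity (\sum_(p <- r) F p); last first.
  rewrite big_allpairs /=; apply: eq_big_seq => a aD; apply: eq_big_seq => b bD.
  by rewrite !fps_truncE aD bD.
transitivity (\sum_(p \in [set p | mmul p.1 p.2 = m]) F p).
  by apply: eq_fsbigr => p; rewrite inE /F => /= ->; rewrite eqxx.
apply: fsbig_fwiden => // p.
  by move=> /= pm; rewrite rP; apply/andP/Dc; rewrite pm.
by move=> [_ /= /eqP/negPf pm]; rewrite /F pm.
Qed.

Lemma malg_mul_congr (D : {fset {cmonom I}}) (p q h : {malg R[{cmonom I}]}) m :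
    divisor_closed D -> m \in D -> (forall k, k \in D -> p@_k = q@_k) ->
  (p * h)@_m = (q * h)@_m.
Proof.
move=> Dc mD pq; apply/eqP; rewrite -subr_eq0 -mcoeffB -mulrBl.
rewrite mcoeffMl big1 // => a _; rewrite big1 // => b _.
have [abm|//] := eqVneq; have [aD _] : a \in D /\ b \in D.
  by apply: Dc; rewrite abm.
by rewrite mcoeffB pq // subrr mul0r.
Qed.

Lemma fps_trunc_mul (D : {fset {cmonom I}}) f g k :
    divisor_closed D -> k \in D ->
  (fps_trunc D (fps_mul f g))@_k = (fps_trunc D f * fps_trunc D g)@_k.
Proof. by move=> Dc kD; rewrite fps_truncE kD (fps_mulE _ _ Dc). Qed.

Lemma fps_mulC : commutative fps_mul.
Proof.
move=> f g; apply: fpsP => m.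
have [D Dc mD] := divisor_closed_ex m.
by rewrite (fps_mulE f g Dc mD) (fps_mulE g f Dc mD) mulrC.
Qed.

Lemma fps_mulA : associative fps_mul.
Proof.
move=> f g h; apply: fpsP => m.
have [D Dc mD] := divisor_closed_ex m.
rewrite (fps_mulE f (fps_mul g h) Dc mD) (fps_mulE (fps_mul f g) h Dc mD).
transitivity ((fps_trunc D g * fps_trunc D h * fps_trunc D f)@_m).
  rewrite [in LHS]mulrC; apply: (malg_mul_congr _ Dc mD) => k kD.
  exact: fps_trunc_mul.
rewrite mulrC mulrA; apply/esym; apply: (malg_mul_congr _ Dc mD) => k kD.
exact: fps_trunc_mul.
Qed.

Lemma fps_mul1 : left_id (fpsC 1) fps_mul.
Proof.
move=> f; apply: fpsP => m.
have [D Dc mD] := divisor_closed_ex m.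
rewrite (fps_mulE (fpsC 1) f Dc mD) (@malg_mul_congr D _ 1) //.
  by rewrite mul1r fps_truncE mD.
by move=> k kD; rewrite fps_truncE kD /= mcoeff1; case: eqP.
Qed.

Lemma fps_mulDl : left_distributive fps_mul fps_add.
Proof.
move=> f g h; apply: fpsP => m.
have [D Dc mD] := divisor_closed_ex m.
rewrite (fps_mulE (fps_add f g) h Dc mD).
transitivity (fpscoef (fps_mul f h) m + fpscoef (fps_mul g h) m) => //.
rewrite (fps_mulE f h Dc mD) (fps_mulE g h Dc mD).
rewrite -mcoeffD -mulrDl; apply: (malg_mul_congr _ Dc mD) => k kD.
by rewrite mcoeffD !fps_truncE kD.
Qed.

Lemma fps_oner_neq0 : fpsC 1 != 0 :> S.
Proof.
apply/eqP => /(congr1 (fun f => fpscoef f mone)) /=.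
by rewrite eqxx; apply/eqP/oner_neq0.
Qed.

HB.instance Definition _ := GRing.Zmodule_isComNzRing.Build S
  fps_mulA fps_mulC fps_mul1 fps_mulDl fps_oner_neq0.

Definition fps_unit : pred S := fun f => `[< exists g, g * f = 1 >].
Definition fps_inv f : S :=
  if pselect (exists g, g * f = 1) is left e then projT1 (cid e) else f.

Lemma fps_mulVr : {in fps_unit, left_inverse 1 fps_inv *%R}.
Proof.
move=> f /asboolP uf; rewrite /fps_inv.
by case: pselect => // e; case: (cid e).
Qed.

Lemma fps_unitPl f g : g * f = 1 -> fps_unit f.
Proof. by move=> gf; apply/asboolP; exists g. Qed.

Lemma fps_inv_out : {in [predC fps_unit], fps_inv =1 id}.
Proof.
move=> f /asboolP nuf; rewrite /fps_inv.
by case: pselect.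
Qed.

HB.instance Definition _ := GRing.ComNzRing_hasMulInverse.Build S
  fps_mulVr fps_unitPl fps_inv_out.

(* The sum of an infinite family of series, taken coefficientwise.  It is only
   meaningful for families in which each monomial occurs in finitely many
   members. *)
Definition fps_sum (J : choiceType) (A : set J) (F : J -> S) : S :=
  FPS (fun m => \sum_(j \in A) fpscoef (F j) m).

Lemma fpscoefM f g m : fpscoef (f * g) m =
  \sum_(p \in [set p : {cmonom I} * {cmonom I} | mmul p.1 p.2 = m])
    fpscoef f p.1 * fpscoef g p.2.
Proof. by []. Qed.

Lemma fpscoefCM c f m : fpscoef (fpsC c * f) m = c * fpscoef f m.
Proof.
rewrite fpscoefM -(fsbig_widen [set (mone, m)]) /=.
- by rewrite fsbig_set1 /= eqxx.
- by move=> p ->; rewrite /= mul1m.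
move=> [a b] /= [abm nab]; have [a1|] := eqVneq; last by rewrite mul0r.
by case: nab; rewrite -abm a1 mul1m.
Qed.

Lemma fpscoefXM i f m :
  fpscoef (fpsX i * f) m = if m i is 0%N then 0 else fpscoef f (divcm m (ucm i)).
Proof.
case mi: (m i) => [|k]; rewrite fpscoefM.
  apply: fsbig1 => -[a b] /= abm; have [ai|] := eqVneq; last by rewrite mul0r.
  by move: mi; rewrite -abm ai mulcmE ucmE eqxx.
rewrite -(fsbig_widen [set (ucm i, divcm m (ucm i))]) /=.
- by rewrite fsbig_set1 /= eqxx mul1r.
- move=> p -> /=; apply/eqP/cmP => j; rewrite mulcmE divcmE ucmE subnKC //.
  by case: eqP => // <-; rewrite mi.
move=> [a b] /= [abm nab]; have [ai|] := eqVneq; last by rewrite mul0r.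
case: nab; rewrite -abm ai; congr pair; apply/eqP/cmP => j.
by rewrite divcmE mulcmE addKn.
Qed.

End FPSRing.

Lemma fps_1BCX_unit (R : comNzRingType) (c : R) :
  1 - fpsC unit c * fpsX R tt \is a GRing.unit.
Proof.
pose g : fps unit R := FPS (fun m => c ^+ m tt).
apply/asboolP; exists g; rewrite mulrBr mulr1 mulrC -mulrA; apply: fpsP => m.
transitivity (fpscoef g m - fpscoef (fpsC unit c * (fpsX R tt * g)) m) => //.
rewrite fpscoefCM fpscoefXM /=; have -> : (m == mone) = (m tt == 0%N).
  apply/eqP/eqP => [->|mt]; first by rewrite onecmE.
  by apply/eqP/cmP => -[]; rewrite mt onecmE.
case mt: (m tt) => [|k]; first by rewrite mulr0 subr0.
by rewrite divcmE ucmE mt eqxx subn1 /= -exprS subrr.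
Qed.

(* Indeterminates x_k, alpha_k, beta_k are numbered from k = 1; the ones with
   index 0 occur nowhere below. *)
Inductive indet := IndX of nat | IndAlpha of nat | IndBeta of nat.

Definition indet_sum (v : indet) : nat + nat + nat :=
  match v with
  | IndX k => inl (inl k) | IndAlpha k => inl (inr k) | IndBeta k => inr k
  end.
Definition sum_indet (v : nat + nat + nat) : indet :=
  match v with
  | inl (inl k) => IndX k | inl (inr k) => IndAlpha k | inr k => IndBeta k
  end.
Lemma indet_sumK : cancel indet_sum sum_indet.
Proof. by case. Qed.

HB.instance Definition _ := Countable.copy indet (can_type indet_sumK).

Definition series := fps indet int.

Definition x_ (k : nat) : series := fpsX int (IndX k).
Definition alpha_ (k : nat) : series := fpsX int (IndAlpha k).
Definition beta_ (k : nat) : series := fpsX int (IndBeta k).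

(* Formal Z-linear combinations of finitely many indeterminates. *)
Definition lincomb := {malg int[indet]}.

Definition A_ (m : nat) : lincomb := \sum_(1 <= k < m.+1) << IndAlpha k >>.
Definition B_ (m : nat) : lincomb := \sum_(1 <= k < m.+1) << IndBeta k >>.
Definition X_ (r s : nat) : lincomb := \sum_(r <= k < s.+1) << IndX k >>.

(* prod_v (1 - v t)^(- c_v), a power series in t = fpsX _ tt *)
Definition hseries (Z : lincomb) : fps unit series :=
  \prod_(v <- msupp Z)
    (1 - fpsC unit (fpsX int v) * fpsX series tt) ^ (- Z@_v).

Definition h_ (m : int) (Z : lincomb) : series :=
  match m with
  | Posz k => fpscoef (hseries Z) (expcmn (ucm tt) k)
  | Negz _ => 0
  end.

Definition h_ominus (m : int) (Y Z : lincomb) : series :=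
  fps_sum [set: nat] (fun b => h_ (m + b%:Z) Y * h_ b%:Z Z).

Definition is_partition n (lambda : 'I_n -> nat) :=
  forall i j : 'I_n, (i <= j)%N -> (lambda j <= lambda i)%N.

(* A finite multiset a_1 <= ... <= a_k with marks, as the sequence of the pairs
   (a_t, whether a_t is marked). *)
Definition marked_seq := seq (nat * bool).

Definition marked_multiset (c : marked_seq) : bool :=
  if c is a :: c' then
    [&& all (fun p => 0 < p.1)%N c, ~~ a.2 &
        path (fun p q => (p.1 <= q.1)%N && (q.2 ==> (p.1 < q.1)%N)) a c']
  else false.

(* The values of a marked multiset are listed in weakly increasing order. *)
Definition minm (c : marked_seq) : nat := head 0%N (map fst c).
Definition maxm (c : marked_seq) : nat := last 0%N (map fst c).
Definition unmarked (c : marked_seq) : nat := count (fun p => ~~ p.2) c.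
Definition marked (c : marked_seq) : nat := count (fun p => p.2) c.

Section Tableaux.
Variables (n : nat) (lambda mu : 'I_n -> nat).

(* The cells of lambda / mu.  The row component is 0-based (it is the row of
   number i.+1), the column component is 1-based. *)
Definition cell : finType :=
  {c : 'I_n * 'I_(\max_i lambda i).+1 | (mu c.1 < c.2 <= lambda c.1)%N}.

Definition cell_row (c : cell) : 'I_n := (val c).1.
Definition cell_col (c : cell) : nat := (val c).2.

Definition filling := {ffun cell -> marked_seq}.

Definition is_tableau (T : filling) : Prop :=
  [/\ forall c, marked_multiset (T c),
      forall c d, cell_row c = cell_row d -> cell_col d = (cell_col c).+1 ->
        (maxm (T c) <= minm (T d))%N &
      forall c d, cell_col c = cell_col d -> cell_row d = (cell_row c).+1 :> nat ->
        (maxm (T c) < minm (T d))%N].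

Definition flagged (r s : 'I_n -> nat) (T : filling) : Prop :=
  forall c, (r (cell_row c) <= minm (T c))%N /\ (maxm (T c) <= s (cell_row c))%N.

Definition wt (T : filling) : series :=
  \prod_(c : cell)
    ((\prod_(p <- T c) x_ p.1) * alpha_ (cell_col c) ^+ (unmarked (T c)).-1
     * (- beta_ (cell_row c).+1) ^+ marked (T c)).

Definition Grow (r s : 'I_n -> nat) : series :=
  fps_sum [set T | is_tableau T /\ flagged r s T] wt.

End Tableaux.

(* Main.v *)
(* The signed generating function of flagged arrays and the determinant satisfy
   the same recursion.  Let row i be the topmost nonempty row with maximal flag
   s_i, and put x = x_{s_i}, alpha = alpha_{lambda_i}, beta = beta_i.  If the
   last cell of row i is a corner, classifying a tableau by the last occurrence of
   s_i in that cell (none, alone, or after other elements and unmarked or marked)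
   gives
     (1 - x alpha) G(lambda, s)
       = (1 - x beta) G(lambda, s - e_i) + x G(lambda - e_i, s),
   while lambda_i = lambda_{i+1} forces s_i = s_{i+1} and
   G(lambda, s) = G(lambda, s - e_i).  On the other side, row i of the matrix
   for (lambda, s - e_i) is (1 - x alpha) times that for (lambda, s) minus x
   times that for (lambda - e_i, s), up to entries which do not contribute
   because the matrix is block triangular at every i with
   lambda_{i+1} <= mu_i. *)
Require Import Defs.
From mathcomp Require Import all_boot all_order all_algebra finmap fingroup perm.
From mathcomp Require Import boolp classical_sets functions cardinality fsbigop.
From mathcomp.multinomials Require Import monalg.
From mathcomp Require Import zify ring.

Set Implicit Arguments.
Unset Strict Implicit.
Unset Printing Implicit Defensive.

Import Order.TTheory GRing.Theory Num.Theory.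
Local Open Scope ring_scope.

(** * Order and summation of power series *)

Section Order.
Variables (I : choiceType) (R : comNzRingType).
Implicit Types (f g : fps I R) (m : {cmonom I}).

(** A lower bound on the order only, so that the zero series satisfies it for every [k]. It serves
    both summability and the uniqueness of fixpoints. *)
Definition ord_ge k f := forall m, (mdeg m < k)%N -> fpscoef f m = 0.

Lemma ord_ge0 f : ord_ge 0 f.
Proof. by move=> m; rewrite ltn0. Qed.

Lemma ord_ge_zero k : ord_ge k 0.
Proof. by move=> m _ /=; rewrite if_same. Qed.

Lemma ord_geD k f g : ord_ge k f -> ord_ge k g -> ord_ge k (f + g).
Proof.
move=> fk gk m mk; rewrite -[LHS]/(fpscoef f m + fpscoef g m).
by rewrite fk // gk // addr0.
Qed.

Lemma ord_geN k f : ord_ge k f -> ord_ge k (- f).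
Proof. by move=> fk m mk; rewrite -[LHS]/(- fpscoef f m) fk // oppr0. Qed.

Lemma ord_geM k l f g : ord_ge k f -> ord_ge l g -> ord_ge (k + l) (f * g).
Proof.
move=> fk gl m mkl; rewrite fpscoefM; apply: fsbig1 => -[a b] /= abm.
have [/fk-> | ka] := ltnP (mdeg a) k; first by rewrite mul0r.
rewrite gl ?mulr0 //; move: mkl; rewrite -abm mdegM; lia.
Qed.

Lemma ord_geMl l f g : ord_ge l g -> ord_ge l (f * g).
Proof. by move=> gl; rewrite -[l]add0n; apply: ord_geM (ord_ge0 f) gl. Qed.

Lemma ord_geX i : ord_ge 1 (fpsX R i).
Proof.
move=> m; rewrite ltnS leqn0 mdeg_eq0 => /eqP -> /=.
by rewrite eq_sym cm1_eq1.
Qed.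

Lemma ord_ge_prod (J : Type) (s : seq J) (P : pred J) (k : J -> nat)
    (F : J -> fps I R) :
  (forall j, ord_ge (k j) (F j)) ->
  ord_ge (\sum_(j <- s | P j) k j)%N (\prod_(j <- s | P j) F j).
Proof.
move=> kF; elim/big_rec2: _ => [|j f l _ fl]; first exact: ord_ge0.
exact: ord_geM.
Qed.

End Order.

Section Summation.
Variables (I : choiceType) (R : comNzRingType).
Local Notation S := (fps I R).
Local Open Scope classical_set_scope.

(** The finitely supported big operator returns 0 on an infinite support, so additivity of [fps_sum]
    rests on each monomial having finitely many contributions. *)
Definition summable (J : choiceType) (A : set J) (F : J -> S) :=
  forall m, finite_set (A `&` [set j | fpscoef (F j) m <> 0]).

Lemma eq_fps_sum (J : choiceType) (A : set J) (F G : J -> S) :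
  (forall j, A j -> F j = G j) -> fps_sum A F = fps_sum A G.
Proof.
by move=> FG; apply: fpsP => m; apply: eq_fsbigr => j /set_mem /FG ->.
Qed.

Lemma fps_sum_image (J K : choiceType) (A : set J) (f : J -> K) (F : K -> S) :
  set_inj A f -> fps_sum (f @` A) F = fps_sum A (F \o f).
Proof. by move=> fi; apply: fpsP => m /=; rewrite fsbig_image. Qed.

Lemma fps_sumU (J : choiceType) (A B : set J) (F : J -> S) :
    summable (A `|` B) F -> A `&` B `<=` set0 ->
  fps_sum (A `|` B) F = fps_sum A F + fps_sum B F.
Proof.
move=> sF AB; apply: fpsP => m.
rewrite -[RHS]/(fpscoef (fps_sum A F) m + fpscoef (fps_sum B F) m) /=.
pose V := [set j | fpscoef (F j) m <> 0].
have supp C : \sum_(j \in C) fpscoef (F j) m = \sum_(j \in C `&` V) fpscoef (F j) m.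
  exact: fsbig_supp.
rewrite (supp (A `|` B)) (supp A) (supp B).
have := sF m; rewrite -/V setIUl finite_setU => -[fA fB].
rewrite fsbigU0 // => j [[Aj _] [Bj _]].
by apply: (AB j); split.
Qed.

Lemma fps_sumD (J : choiceType) (A : set J) (F G : J -> S) :
    summable A F -> summable A G ->
  fps_sum A (fun j => F j + G j) = fps_sum A F + fps_sum A G.
Proof.
move=> sF sG; apply: fpsP => m.
rewrite -[RHS]/(fpscoef (fps_sum A F) m + fpscoef (fps_sum A G) m) /=.
(* The union of both supports is finite and contains the support of the sum, so all three sums can
   be taken over it. *)
pose X := (A `&` [set j | fpscoef (F j) m <> 0]) `|`
          (A `&` [set j | fpscoef (G j) m <> 0]).
have fX : finite_set X by rewrite finite_setU.
have XA : X `<=` A by move=> j [] [].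
have wX (H : J -> S) : (forall j, A j -> ~ X j -> fpscoef (H j) m = 0) ->
    \sum_(j \in A) fpscoef (H j) m = \sum_(j \in X) fpscoef (H j) m.
  by move=> H0; apply/esym/fsbig_widen => // j [Aj nXj]; apply: H0.
have XF j : A j -> ~ X j -> fpscoef (F j) m = 0.
  by move=> Aj nX; apply: contrapT => ?; apply: nX; left; split.
have XG j : A j -> ~ X j -> fpscoef (G j) m = 0.
  by move=> Aj nX; apply: contrapT => ?; apply: nX; right; split.
rewrite (wX F) // (wX G) // -fsbig_split //.
apply: (wX (fun j => F j + G j)) => j Aj nX.
by rewrite -[LHS]/(fpscoef (F j) m + fpscoef (G j) m) XF // XG // addr0.
Qed.

Lemma fps_sum0 (J : choiceType) (A : set J) (F : J -> S) :
  (forall j, A j -> F j = 0) -> fps_sum A F = 0.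
Proof.
move=> F0; apply: fpsP => m /=; rewrite if_same.
by apply: fsbig1 => j /F0 -> /=; rewrite if_same.
Qed.

Lemma fps_sumN (J : choiceType) (A : set J) (F : J -> S) :
  summable A F -> fps_sum A (fun j => - F j) = - fps_sum A F.
Proof.
move=> sF; apply/eqP; rewrite -addr_eq0 addrC -fps_sumD //.
  by apply/eqP/fps_sum0 => j _; rewrite subrr.
move=> m; apply: sub_finite_set (sF m) => j [Aj /= Fj]; split=> // F0.
by apply: Fj; rewrite F0 oppr0.
Qed.

(** Multiplication by an indeterminate only shifts coefficients, so the two sides agree coefficient
    by coefficient. *)
Lemma fps_sumXM (J : choiceType) (A : set J) (F : J -> S) i :
  fps_sum A (fun j => fpsX R i * F j) = fpsX R i * fps_sum A F.
Proof.
apply: fpsP => m; rewrite fpscoefXM -[LHS]/(\sum_(j \in A) fpscoef (fpsX R i * F j) m).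
case mi: (m i) => [|k]; first by apply: fsbig1 => j _; rewrite fpscoefXM mi.
by apply: eq_fsbigr => j _; rewrite fpscoefXM mi.
Qed.

Lemma fps_sum_shift (F : nat -> S) : F 0%N = 0 ->
  fps_sum [set: nat] F = fps_sum [set: nat] (fun b => F b.+1).
Proof.
move=> F0; rewrite -(@fps_sum_image _ _ _ succn); last by move=> ? ? _ _ [].
apply: fpsP => m /=; apply/esym/fsbig_widen => // -[_ /= | b [_ /= []]].
  by rewrite F0 /= if_same.
by exists b.
Qed.

Lemma fps_sum_head (F : nat -> S) : (forall b, F b.+1 = 0) ->
  fps_sum [set: nat] F = F 0%N.
Proof.
move=> F0; apply: fpsP => m; rewrite -[LHS]/(\sum_(b \in [set: nat]) fpscoef (F b) m).
rewrite -(fsbig_widen [set 0%N]) ?fsbig_set1 // => -[|b] [_ /= nb]; first by case: nb.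
by rewrite F0 /= if_same.
Qed.

Lemma ord_ge_summable (J : choiceType) (A : set J) (F : J -> S) (k : J -> nat) :
    (forall j, A j -> ord_ge (k j) (F j)) ->
    (forall d, finite_set (A `&` [set j | (k j <= d)%N])) ->
  summable A F.
Proof.
move=> kF fk m; apply: sub_finite_set (fk (mdeg m)) => j [Aj Fj].
by split=> //=; rewrite leqNgt; apply/negP => /(kF _ Aj).
Qed.

Lemma ord_ge_nat_summable (F : nat -> S) :
  (forall b, ord_ge b (F b)) -> summable [set: nat] F.
Proof.
move=> oF; apply: (@ord_ge_summable _ _ _ id) => // d.
by rewrite setTI; apply: sub_finite_set (finite_II d.+1) => b /=.
Qed.

Lemma sub_summable (J : choiceType) (A B : set J) (F : J -> S) :
  A `<=` B -> summable B F -> summable A F.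
Proof. by move=> AB sF m; apply: sub_finite_set (sF m) => j [/AB]. Qed.

Lemma summableXM (J : choiceType) (A : set J) (F : J -> S) i :
  summable A F -> summable A (fun j => fpsX R i * F j).
Proof.
move=> sF m; apply: sub_finite_set (sF (divcm m (ucm i))) => j [Aj XF].
split=> // F0; apply: XF; rewrite fpscoefXM.
by case: (m i) => // k; apply: F0.
Qed.

End Summation.

(** * Complete homogeneous series *)

(* Unification would unfold the ring of power series if this were stated for
   [hseries] directly. *)
Lemma prod_exprzN_pred (J : choiceType) (A : comUnitRingType) (fac : J -> A)
    (W Z : {malg int[J]}) (v : J) :
    (forall w, fac w \is a GRing.unit) ->
    W@_v = Z@_v - 1 -> (forall w, w != v -> W@_w = Z@_w) ->
  \prod_(w <- msupp W) fac w ^ (- W@_w) =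
    fac v * \prod_(w <- msupp Z) fac w ^ (- Z@_w).
Proof.
(* Both products are extended to one finite set [D]; the added factors have exponent 0. *)
move=> facU Wv Ww; pose D := (msupp Z `|` msupp W `|` [fset v])%fset.
have vD : v \in D by rewrite !inE eqxx orbT.
have widen (Y : {malg int[J]}) : (msupp Y `<=` D)%fset ->
    \prod_(w <- msupp Y) fac w ^ (- Y@_w) = \prod_(w <- D) fac w ^ (- Y@_w).
  move=> YD; apply: big_fset_incl => // w _; rewrite -mcoeff_eq0 => /eqP ->.
  by rewrite oppr0 expr0z.
rewrite !widen; last 2 first.
- by apply: fsubset_trans (fsubsetUl _ _); apply: fsubsetUl.
- by apply: fsubset_trans (fsubsetUl _ _); apply: fsubsetUr.
clearbody D; rewrite (big_fsetD1 v vD) [in RHS](big_fsetD1 v vD) /= mulrA.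
rewrite Wv opprB exprzDr ?expr1z //; congr (_ * _).
by apply: eq_big_seq => w; rewrite !inE => /andP[wv _]; rewrite Ww.
Qed.

Section CompleteHomogeneous.
Implicit Types (Y Z : lincomb) (v : indet) (m : int) (b k : nat).

(** Every combination arises from 0 by adding and subtracting single indeterminates, so facts about
    [h_] follow from its one-step recursions. *)
Lemma lincomb_ind (P : lincomb -> Prop) :
    P 0 -> (forall Z v, P Z -> P (Z + << v >>)) ->
    (forall Z v, P Z -> P (Z - << v >>)) ->
  forall Z, P Z.
Proof.
move=> P0 PD PB Z; rewrite (monalgE Z).
elim/big_rec: _ => // v Y _; rewrite addrC; elim/int_ind: (Z@_v) Y => [|k IH|k IH] Y PY.
- by rewrite monalgU0 addr0.
- by rewrite -addn1 PoszD monalgUD addrA; apply/PD/IH.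
- by rewrite -addn1 PoszD opprD monalgUB addrA; apply/PB/IH.
Qed.

Lemma hseriesB Z v :
  hseries (Z - << v >>) = (1 - fpsC unit (fpsX int v) * fpsX series tt) * hseries Z.
Proof.
apply: (prod_exprzN_pred
  (fac := fun w => 1 - fpsC unit (fpsX int w) * fpsX series tt)) => [w||w wv].
- exact: fps_1BCX_unit.
- by rewrite mcoeffB mcoeffUU.
- by rewrite mcoeffB mcoeffU eq_sym (negPf wv) subr0.
Qed.

Lemma expcmnE k : expcmn (ucm tt) k tt = k.
Proof.
rewrite /expcmn; elim: k => [|k IH]; first exact: onecmE.
case: k IH => [_|k IH]; first by rewrite -[iterop _ _ _ _]/(ucm tt) ucmE eqxx.
by rewrite -[iterop _ _ _ _]/(mulcm _ (iterop k.+1 (@mulcm _) (ucm tt) (onecm _))) mulcmE IH ucmE.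
Qed.

(** The coefficient of t^m in [hseriesB], extended to negative [m], where all terms are 0. *)
Lemma h_B m Z v : h_ m (Z - << v >>) = h_ m Z - fpsX int v * h_ (m - 1) Z.
Proof.
case: m => [k|k] /=; last by rewrite mulr0 subr0.
rewrite hseriesB mulrBl mul1r -mulrA.
set f := hseries Z; set t := expcmn _ _.
transitivity (fpscoef f t - fpscoef (fpsC unit (fpsX int v) * (fpsX series tt * f)) t) => //.
rewrite fpscoefCM fpscoefXM expcmnE.
case: k @t => [|k] t; first by rewrite !mulr0.
rewrite [X in h_ X _](_ : _ = k%:Z); last by lia.
congr (_ - _ * fpscoef _ _); apply/eqP/cmP => -[].
by rewrite divcmE !expcmnE ucmE eqxx subn1.
Qed.

(** Solved for the larger combination, [h_B] becomes a recursion on [m] with [Z + << v >>] on both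
    sides. *)
Lemma h_D m Z v :
  h_ m (Z + << v >>) = h_ m Z + fpsX int v * h_ (m - 1) (Z + << v >>).
Proof. by rewrite -[in h_ m Z](addrK << v >> Z) h_B subrK. Qed.

Lemma h_neg m Z : m < 0 -> h_ m Z = 0.
Proof. by case: m. Qed.

Lemma h_0 m : h_ m 0 = (m == 0)%:R.
Proof.
case: m => [k|k] //=; rewrite /hseries msupp0 big_seq_fset0 /=.
have -> : (expcmn (ucm tt) k == mone) = (k == 0%N).
  apply/eqP/eqP => [/(congr1 (fun c : {cmonom unit} => c tt)) | ->] //.
  by rewrite expcmnE onecmE.
by case: k.
Qed.

Lemma h0 Z : h_ 0 Z = 1.
Proof.
elim/lincomb_ind: Z => [|Z v IH|Z v IH]; first by rewrite h_0.
  by rewrite h_D IH h_neg ?mulr0 ?addr0.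
by rewrite h_B IH h_neg ?mulr0 ?subr0.
Qed.

(** In [h_B] and [h_D] each drop of the index by one is paid for by a factor of degree one. The
    bound makes the sum over [b] in [h_ominus] summable. *)
Lemma h_ord k Z : ord_ge k (h_ k%:Z Z).
Proof.
elim/lincomb_ind: Z k => [|Z v IH|Z v IH] k.
- rewrite h_0; case: k => [|k]; [exact: ord_ge0|exact: ord_ge_zero].
- elim: k => [|k IHk]; first exact: ord_ge0.
  rewrite h_D [X in h_ X (_ + _)](_ : _ = k%:Z); last by lia.
  by apply: ord_geD => //; rewrite -add1n; apply: ord_geM (ord_geX _ _) IHk.
case: k => [|k]; first exact: ord_ge0.
rewrite h_B [X in _ * h_ X _](_ : _ = k%:Z); last by lia.
apply: ord_geD => //; apply: ord_geN.
by rewrite -add1n; apply: ord_geM (ord_geX _ _) (IH _).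
Qed.

Lemma h_ominus_summable m Y Z (F : nat -> series) :
    (forall b, F b = h_ (m + b%:Z) Y * h_ b%:Z Z) ->
  summable [set: nat]%classic F.
Proof.
move=> FE; apply: ord_ge_nat_summable => b; rewrite FE.
exact/ord_geMl/h_ord.
Qed.

(** By [h_B] the second term carries the index [b - 1] on [Z]; shifting [b] raises [m] by one,
    whereas removing [v] from [Y] lowers it. *)
Lemma h_ominus_Br m Y Z v :
  h_ominus m Y (Z - << v >>) = h_ominus m Y Z - fpsX int v * h_ominus (m + 1) Y Z.
Proof.
pose G b := h_ (m + b%:Z) Y * h_ (b%:Z - 1) Z.
have -> : h_ominus (m + 1) Y Z = fps_sum [set: nat]%classic G.
  rewrite fps_sum_shift; last by rewrite /G (@h_neg (_ - 1)) ?mulr0.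
  apply: eq_fps_sum => b _; rewrite /G.
  have -> : m + b.+1%:Z = m + 1 + b%:Z by lia.
  by have -> : b.+1%:Z - 1 = b%:Z by lia.
have sG : summable [set: nat]%classic (fun b => fpsX int v * G b).
  apply: ord_ge_nat_summable => -[|b]; first exact: ord_ge0.
  rewrite -add1n; apply: ord_geM (ord_geX _ _) _; apply: ord_geMl; rewrite [_ - 1](_ : _ = b%:Z); last by lia.
  exact: h_ord.
rewrite -fps_sumXM -fps_sumN // -fps_sumD //.
- by apply: eq_fps_sum => b _; rewrite h_B mulrBr mulrCA.
- exact: h_ominus_summable.
by move=> k; apply: sub_finite_set (sG k) => b [_ /= nz]; split=> // z; apply: nz; rewrite z oppr0.
Qed.

Lemma h_ominus_Bl m Y Z v :
  h_ominus m (Y - << v >>) Z = h_ominus m Y Z - fpsX int v * h_ominus (m - 1) Y Z.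
Proof.
have sG : summable [set: nat]%classic
    (fun b => - (fpsX int v * (h_ (m - 1 + b%:Z) Y * h_ b%:Z Z))).
  apply: ord_ge_nat_summable => b; apply: ord_geN.
  exact/ord_geMl/ord_geMl/h_ord.
rewrite -fps_sumXM -fps_sumN //; last first.
  move=> k; apply: sub_finite_set (sG k) => b [_ /= nz]; split=> // z; apply: nz.
  by rewrite -[LHS]opprK z oppr0.
rewrite -fps_sumD //; last exact: h_ominus_summable.
apply: eq_fps_sum => b _; rewrite h_B mulrBl mulrA.
by have -> : m + b%:Z - 1 = m - 1 + b%:Z by lia.
Qed.

Lemma h_ominus_0r m Y : h_ominus m Y 0 = h_ m Y.
Proof.
rewrite /h_ominus fps_sum_head => [|b]; last by rewrite h_0 mulr0.
by rewrite h0 mulr1 addr0.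
Qed.

Lemma h_ominus_0l_gt0 m Z : 0 < m -> h_ominus m 0 Z = 0.
Proof.
move=> m0; apply: fps_sum0 => b _; rewrite h_0.
by rewrite gt_eqF ?mul0r //; lia.
Qed.

Lemma h_ominus_00l Z : h_ominus 0 0 Z = 1.
Proof.
rewrite /h_ominus fps_sum_head => [|b]; last by rewrite h_0 mul0r.
by rewrite !h0 mulr1.
Qed.

End CompleteHomogeneous.

(** * Determinants *)

Section BlockTriangular.
Variables (n : nat) (R : comNzRingType).
Implicit Types (M N : 'M[R]_n) (s : {perm 'I_n}).

(** Block upper triangularity, the first diagonal block having the indices 0 to [k]. *)
Definition lower_zero M (k : nat) :=
  forall a b : 'I_n, (b <= k < a)%N -> M a b = 0.

(** A permutation mapping the final segment into itself maps it onto itself, by counting, so nothing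
    else can enter it. *)
Lemma perm_preserves_initial s (k : nat) (a : 'I_n) :
  (forall b : 'I_n, (k < b)%N -> (k < s b)%N) -> (a <= k)%N -> (s a <= k)%N.
Proof.
move=> sU ak; rewrite leqNgt; apply/negP => ksa.
pose U := [set b : 'I_n | (k < b)%N].
have sUU : s @: U = U.
  apply/eqP; rewrite eqEcard card_imset ?leqnn ?andbT; last exact: perm_inj.
  by apply/fintype.subsetP => _ /imsetP[b bU ->]; move: bU; rewrite !inE; apply: sU.
have : s a \in s @: U by rewrite sUU inE.
by rewrite mem_imset ?inE ?ltnNge ?ak //; apply: perm_inj.
Qed.

(** A permutation that moves some index up across [k] must move another one down across [k], where
    it meets a zero of the lower left block. *)
Lemma prod_perm_lower_zero M s (k : nat) (a : 'I_n) :
  lower_zero M k -> (a <= k < s a)%N -> \prod_i M i (s i) = 0.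
Proof.
move=> Mk /andP[ak ksa].
have [/forall_inP sU|] := boolP [forall (b : 'I_n | (k < b)%N), (k < s b)%N].
  by have := perm_preserves_initial sU ak; rewrite leqNgt ksa.
rewrite negb_forall_in => /exists_inP[b kb]; rewrite -leqNgt => sbk.
by rewrite (bigD1 b) //= Mk ?mul0r // sbk.
Qed.

(** Entries in the upper right block of a block triangular matrix never contribute to the Leibniz
    expansion, so they may be altered freely. *)
Lemma det_eq_upto_lower_zero M N :
    (forall a b, M a b = N a b \/
      exists2 k : nat, (a <= k < b)%N & lower_zero M k /\ lower_zero N k) ->
  \det M = \det N.
Proof.
move=> MN; apply: eq_bigr => s _; congr (_ * _).
have [/forallP MNs|] := boolP [forall a, M a (s a) == N a (s a)].
  by apply: eq_bigr => a _; apply/eqP.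
rewrite negb_forall => /existsP[a /eqP].
have [//|[k aks [Mk Nk]] _] := MN a (s a).
by rewrite !(@prod_perm_lower_zero _ s k a).
Qed.

(** Every permutation hits the rectangle of rows up to [j] and columns from [j] on: otherwise it
    would inject the [j + 1] indices up to [j] into the [j] indices below [j]. *)
Lemma det_eq0_upto_lower_zero M (j : 'I_n) :
    (forall a b : 'I_n, (a <= j <= b)%N -> M a b = 0 \/
      exists2 k : nat, (a <= k < b)%N & lower_zero M k) ->
  \det M = 0.
Proof.
move=> Mj; apply: big1 => s _.
suff [a ajs] : exists a : 'I_n, (a <= j <= s a)%N.
  have [Ma|[k aks Mk]] := Mj _ _ ajs; first by rewrite (bigD1 a) //= Ma mul0r mulr0.
  by rewrite (prod_perm_lower_zero Mk aks) mulr0.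
apply/existsP; apply: contraT; rewrite negb_exists => /forallP sj.
pose U := [set a : 'I_n | (a <= j)%N].
have : (#|s @: U| <= #|U :\ j|)%N.
  apply/subset_leq_card/fintype.subsetP => _ /imsetP[a + ->]; rewrite inE => aU.
  have := sj a; rewrite aU /= -ltnNge !inE => saj.
  by rewrite (ltnW saj) andbT -val_eqE /= ltn_eqF.
by rewrite card_imset; [rewrite (cardsD1 j U) inE leqnn ltnn | apply: perm_inj].
Qed.

End BlockTriangular.

Lemma det_row_add (R : comNzRingType) n (M N : 'M[R]_n) (i k : 'I_n) (c : R) :
    i != k -> (forall b, M i b = M k b + c * N i b) ->
    (forall a b, a != i -> M a b = N a b) ->
  \det M = c * \det N.
Proof.
(* [K] has row [k] of [N] also in place of row [i], so its determinant vanishes and only the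
   multiple of [N] survives. *)
move=> ik Mi MN; pose K := \matrix_(a, b) (if a == i then N k b else N a b).
rewrite (@determinant_multilinear _ _ M K N i 1 c).
- rewrite (@determinant_alternate _ _ K _ _ ik) ?mulr0 ?add0r //.
  by move=> b; rewrite !mxE eqxx eq_sym (negPf ik).
- by apply/rowP => b; rewrite !mxE eqxx mul1r Mi MN // eq_sym.
- by apply/matrixP => a b; rewrite !mxE eq_sym (negPf (neq_lift i a)) MN // eq_sym neq_lift.
- by apply/matrixP => a b; rewrite !mxE MN // eq_sym neq_lift.
Qed.

(** * Recurrences and vanishing of the matrix entries *)

Section Entries.
Implicit Types l m i j a b : nat.

Lemma A_S l : A_ l.+1 = A_ l + << IndAlpha l.+1 >>.
Proof. by rewrite /A_ big_nat_recr. Qed.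

Lemma B_S l : B_ l.+1 = B_ l + << IndBeta l.+1 >>.
Proof. by rewrite /B_ big_nat_recr. Qed.

Lemma X_S a b : (a <= b.+1)%N -> X_ a b.+1 = X_ a b + << IndX b.+1 >>.
Proof. by move=> ab; rewrite /X_ big_nat_recr. Qed.

Lemma X_empty a b : (b < a)%N -> X_ a b = 0.
Proof. by move=> ab; rewrite /X_ big_geq. Qed.

(** Here [l], [m], [a], [b] stand for lambda_i, mu_j, r_j, s_i. The indices [i] and [j] are 0-based,
    hence [B_ i] and [B_ j.+1]. *)
Definition jt_entry l m i j a b : series :=
  h_ominus (l%:Z - m%:Z - i%:Z + j%:Z) (X_ a b) (A_ l - A_ m - B_ i + B_ j.+1).

(** Removing [x_ b.+1] from the first argument yields a term of index lowered by one; removing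
    [alpha_ l.+1] from the second argument rewrites that term through the entry for [l]. *)
Lemma jt_entry_flag_pred l m i j a b : (a <= b.+1)%N ->
  jt_entry l.+1 m i j a b = (1 - x_ b.+1 * alpha_ l.+1) * jt_entry l.+1 m i j a b.+1
    + (- x_ b.+1) * jt_entry l m i j a b.+1.
Proof.
move=> ab; rewrite /jt_entry.
set Z := A_ l.+1 - _ - _ + _; set k := _ + j%:Z.
have -> : A_ l - A_ m - B_ i + B_ j.+1 = Z - << IndAlpha l.+1 >>.
  by rewrite /Z A_S (addrAC (A_ l) <<_>>) (addrAC _ <<_>>) (addrAC _ <<_>>) addrK.
have -> : l%:Z - m%:Z - i%:Z + j%:Z = k - 1 by rewrite /k; lia.
have -> : X_ a b = X_ a b.+1 - << IndX b.+1 >> by rewrite X_S // addrK.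
rewrite h_ominus_Bl h_ominus_Br subrK -/(x_ _) -/(alpha_ _).
by move: (h_ominus _ _ _) (h_ominus _ _ _) (x_ _) (alpha_ _) => p q x y; ring.
Qed.

Lemma jt_entry_next_row l m i j a b :
  jt_entry l m i j a b = jt_entry l.+1 m i.+1 j a b
    + (beta_ i.+1 - alpha_ l.+1) * jt_entry l.+1 m i j a b.
Proof.
rewrite /jt_entry.
set Z := A_ l.+1 - A_ m - B_ i + _; set k := l.+1%:Z - _ - i%:Z + j%:Z.
have -> : A_ l - A_ m - B_ i + B_ j.+1 = Z - << IndAlpha l.+1 >>.
  by rewrite /Z A_S (addrAC (A_ l) <<_>>) (addrAC _ <<_>>) (addrAC _ <<_>>) addrK.
have -> : A_ l.+1 - A_ m - B_ i.+1 + B_ j.+1 = Z - << IndBeta i.+1 >>.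
  by rewrite /Z B_S opprD addrA (addrAC _ (- <<_>>)).
have -> : l%:Z - m%:Z - i%:Z + j%:Z = k - 1 by rewrite /k; lia.
have -> : l.+1%:Z - m%:Z - i.+1%:Z + j%:Z = k - 1 by rewrite /k; lia.
rewrite !h_ominus_Br subrK -/(beta_ _) -/(alpha_ _).
by move: (h_ominus _ _ _) (h_ominus _ _ _) (beta_ _) (alpha_ _) => p q x y; ring.
Qed.

(** The second argument is minus a sum of [d + e] indeterminates. Removing each raises the index by
    at most one, so all resulting indices stay negative. *)
Lemma h_ominus_low (k : int) (Y : lincomb) l j (d e : nat) : k < - (d + e)%:Z ->
  h_ominus k Y (A_ l - A_ (l + d) - B_ (j + e) + B_ j) = 0.
Proof.
elim: d k => [|d IHd] k kd.
  rewrite addn0 subrr sub0r; elim: e k kd => [|e IHe] k ke.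
    by rewrite addn0 addNr h_ominus_0r h_neg //; lia.
  rewrite addnS B_S opprD addrAC h_ominus_Br !IHe ?mulr0 ?subr0 //; lia.
rewrite addnS A_S opprD addrA (addrAC _ (- <<_>>)) (addrAC _ (- <<_>>)).
by rewrite h_ominus_Br !IHd ?mulr0 ?subr0 //; lia.
Qed.

Lemma jt_entry_low l m i j a b : (j < i)%N -> (l <= m)%N -> jt_entry l m i j a b = 0.
Proof.
move=> ji lm; rewrite /jt_entry -(subnKC lm) -(subnKC ji).
apply: h_ominus_low; lia.
Qed.

(** The entry is the sum over b of h_b[X] beta^b, which is the inverse of the product; the factors
    are peeled off one [x_ k] at a time. *)
Lemma jt_entry_diag l i a b : (0 < a)%N ->
  (\prod_(a <= k < b.+1) (1 - beta_ i.+1 * x_ k)) * jt_entry l l i i a b = 1.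
Proof.
move=> a_gt0; rewrite /jt_entry.
have -> : l%:Z - l%:Z - i%:Z + i%:Z = 0 by lia.
have -> : A_ l - A_ l - B_ i + B_ i.+1 = << IndBeta i.+1 >>.
  by rewrite B_S subrr sub0r addKr.
elim: b => [|b IH].
  by rewrite X_empty // h_ominus_00l mulr1 big_geq.
have [ab|ba] := leqP a b.+1; last first.
  by rewrite X_empty // h_ominus_00l mulr1 big_geq.
rewrite big_nat_recr //=; move: IH; set P := (X in X * _ = 1) => IH.
rewrite -[RHS]IH -[X in _ = _ * h_ominus _ X _](addrK << IndX b.+1 >>).
rewrite -X_S // h_ominus_Bl sub0r -/(x_ _).
(* Taking beta away from itself leaves [h_ (- 1)], which is 0, so the term of index -1 is beta times
   the term of index 0. *)
have := h_ominus_Br (- 1) (X_ a b.+1) << IndBeta i.+1 >> (IndBeta i.+1).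
rewrite subrr h_ominus_0r h_neg // addNr -/(beta_ _) => /esym/eqP.
rewrite subr_eq0 => /eqP ->.
rewrite -/P; clearbody P; clear IH.
by move: (h_ominus _ _ _) (x_ _) (beta_ _) => p x y; ring.
Qed.

Lemma jt_entry_empty l m i j a b : (b < a)%N -> (i <= j)%N -> (m < l)%N ->
  jt_entry l m i j a b = 0.
Proof. by move=> ba ij ml; rewrite /jt_entry X_empty // h_ominus_0l_gt0 //; lia. Qed.

End Entries.

(** * Tableaux as arrays *)

Section MarkedMultisets.
Implicit Types (c : marked_seq) (p : nat * bool).

Lemma minm_rcons c p : c != [::] -> minm (rcons c p) = minm c.
Proof. by case: c. Qed.

Lemma maxm_rcons c p : maxm (rcons c p) = p.1.
Proof. by rewrite /maxm map_rcons last_rcons. Qed.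

Lemma unmarked_rcons c p : unmarked (rcons c p) = (unmarked c + ~~ p.2)%N.
Proof. by rewrite /unmarked -cats1 count_cat /= addn0. Qed.

Lemma marked_rcons c p : marked (rcons c p) = (marked c + p.2)%N.
Proof. by rewrite /marked -cats1 count_cat /= addn0. Qed.

Lemma marked_multiset_seq1 p : marked_multiset [:: p] = (0 < p.1)%N && ~~ p.2.
Proof. by rewrite /= !andbT. Qed.

Lemma marked_multiset_rcons c p : c != [::] ->
  marked_multiset (rcons c p) =
  [&& marked_multiset c, (0 < p.1)%N, (maxm c <= p.1)%N & p.2 ==> (maxm c < p.1)%N].
Proof.
case: c => // a c _; rewrite rcons_cons /= all_rcons rcons_path /maxm /= last_map.
by case: (0 < p.1)%N; case: (0 < a.1)%N; case: (~~ a.2); case: all; case: path;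
  rewrite ?andbF.
Qed.

(** Induction at the largest element, the end at which the corner recursion alters a cell. *)
Lemma marked_multiset_rcons_ind (P : marked_seq -> Prop) :
    (forall p, (0 < p.1)%N -> ~~ p.2 -> P [:: p]) ->
    (forall c p, c != [::] -> marked_multiset c -> P c -> (0 < p.1)%N ->
      (maxm c <= p.1)%N -> (p.2 -> maxm c < p.1)%N -> P (rcons c p)) ->
  forall c, marked_multiset c -> P c.
Proof.
move=> P1 PS; elim/last_ind => // c p IH.
have [-> | c0] := eqVneq c [::].
  by rewrite marked_multiset_seq1 => /andP[]; apply: P1.
rewrite marked_multiset_rcons // => /and4P[mc p0 cp /implyP pc].
by apply: PS => //; apply: IH.
Qed.

Lemma marked_multiset_neq0 c : marked_multiset c -> c != [::].
Proof. by case: c. Qed.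

Lemma minm_le_maxm c : marked_multiset c -> (minm c <= maxm c)%N.
Proof.
elim/marked_multiset_rcons_ind => // {}c p c0 _ IH _ cp _.
by rewrite minm_rcons // maxm_rcons (leq_trans IH).
Qed.

Lemma unmarked_gt0 c : marked_multiset c -> (0 < unmarked c)%N.
Proof.
elim/marked_multiset_rcons_ind => [p _ p2|{}c p _ _ IH _ _ _].
  by rewrite /unmarked /= p2.
by rewrite unmarked_rcons addn_gt0 IH.
Qed.

Lemma all_le_maxm c : marked_multiset c -> all (fun p => p.1 <= maxm c)%N c.
Proof.
elim/marked_multiset_rcons_ind => [p _ _|{}c p _ _ IH _ cp _].
  by rewrite /= leqnn.
rewrite all_rcons maxm_rcons leqnn /=; apply: sub_all IH => q qc.
exact: leq_trans cp.
Qed.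

End MarkedMultisets.

Lemma finite_bounded_marked_seqs (d b : nat) : exists cs : seq marked_seq,
  forall c, (size c <= d)%N -> all (fun p => p.1 <= b)%N c -> c \in cs.
Proof.
exists [seq [seq (nat_of_ord p.1, p.2) | p <- bseqval c] | c <- enum {: d.-bseq ('I_b.+1 * bool)}].
move=> c cd /allP cb; pose e := [seq (inord p.1 : 'I_b.+1, p.2) | p <- c].
have ed : (size e <= d)%N by rewrite size_map.
apply/mapP; exists (Bseq ed); first by rewrite mem_enum.
rewrite /= -map_comp -[LHS]map_id; apply/eq_in_map => -[k m] /cb /= kb.
by rewrite inordK.
Qed.

(** * Arrays: comparison with tableaux, summability, change of one cell *)

Section Arrays.
Variable n : nat.
Implicit Types (lambda mu r s : 'I_n -> nat) (i k : 'I_n) (j : nat).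

(* A tableau as a function on all positions, empty outside the shape. *)
Definition array := 'I_n -> nat -> marked_seq.
Implicit Types (T : array).

Definition in_shape lambda mu i j := (mu i < j <= lambda i)%N.

Record is_array lambda mu r s T : Prop := IsArray {
  array_out : forall i j, ~~ in_shape lambda mu i j -> T i j = [::];
  array_cell : forall i j, in_shape lambda mu i j -> marked_multiset (T i j);
  array_min : forall i j, in_shape lambda mu i j -> (r i <= minm (T i j))%N;
  array_max : forall i j, in_shape lambda mu i j -> (maxm (T i j) <= s i)%N;
  array_row : forall i j, in_shape lambda mu i j -> in_shape lambda mu i j.+1 ->
    (maxm (T i j) <= minm (T i j.+1))%N;
  array_col : forall i k j, k = i.+1 :> nat ->
    in_shape lambda mu i j -> in_shape lambda mu k j ->
    (maxm (T i j) < minm (T k j))%N }.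

Definition arrays lambda mu r s : set array := [set T | is_array lambda mu r s T]%classic.

Definition cell_wt (i j : nat) (c : marked_seq) : series :=
  (\prod_(p <- c) x_ p.1) * alpha_ j ^+ (unmarked c).-1 * (- beta_ i.+1) ^+ marked c.

Definition array_wt lambda mu T : series :=
  \prod_i \prod_((mu i).+1 <= j < (lambda i).+1) cell_wt i j (T i j).

Definition array_sum lambda mu r s : series :=
  fps_sum (arrays lambda mu r s) (array_wt lambda mu).

(** Restriction to the cells is a weight-preserving bijection from arrays to fillings. The type of
    arrays does not depend on the shape, so different shapes can be compared. *)
Lemma Grow_array_sum lambda mu r s : Grow lambda mu r s = array_sum lambda mu r s.
Proof.
pose fill (T : array) : filling lambda mu :=
  [ffun c : cell lambda mu => T (cell_row c) (cell_col c)].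
have cellP (c : cell lambda mu) : in_shape lambda mu (cell_row c) (cell_col c).
  exact: (valP c).
have ex_cell i j : in_shape lambda mu i j ->
    exists c : cell lambda mu, cell_row c = i /\ cell_col c = j.
  move=> sh; have jL : (j < (\max_i lambda i).+1)%N.
    by case/andP: sh => _ jl; rewrite ltnS (leq_trans jl) // leq_bigmax.
  by exists (exist _ (i, Ordinal jL) sh).
have cell_inj (c d : cell lambda mu) :
    cell_row c = cell_row d -> cell_col c = cell_col d -> c = d.
  move=> cd1 cd2; apply: val_inj; apply/eqP; rewrite -pair_eqE /=.
  by apply/andP; split; [apply/eqP|apply/eqP/val_inj].
have fillE : [set T | is_tableau T /\ flagged r s T]%classic =
    (fill @` arrays lambda mu r s)%classic.
  apply/seteqP; split => [T [[T1 T2 T3] T4] | _ [T [T1 T2 T3 T4 T5 T6] <-]] /=.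
    pose U : array := fun i j =>
      if [pick c : cell lambda mu | (cell_row c == i) && (cell_col c == j)] is Some c
      then T c else [::].
    have UE c : U (cell_row c) (cell_col c) = T c.
      rewrite /U; case: pickP => [d /andP[/eqP ? /eqP ?]|/(_ c)].
        by congr (T _); apply: cell_inj.
      by rewrite !eqxx.
    exists U; last by apply/ffunP => c; rewrite ffunE UE.
    split.
    - move=> i j nsh; rewrite /U; case: pickP => // c /andP[/eqP ci /eqP cj].
      by move: nsh; rewrite -ci -cj cellP.
    - by move=> i j /ex_cell[c [<- <-]]; rewrite UE.
    - by move=> i j /ex_cell[c [<- <-]]; rewrite UE; case: (T4 c).
    - by move=> i j /ex_cell[c [<- <-]]; rewrite UE; case: (T4 c).
    - move=> i j /ex_cell[c [ci cj]] /ex_cell[d [di dj]].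
      by have := T2 c d; rewrite -(UE c) -(UE d) ci cj di dj; apply.
    - move=> i k j ki /ex_cell[c [ci cj]] /ex_cell[d [di dj]].
      by have := T3 c d; rewrite -(UE c) -(UE d) ci cj di dj; apply.
  split; first split.
  - by move=> c; rewrite ffunE; apply: T2.
  - move=> c d cd1 cd2; rewrite !ffunE -cd1 cd2; apply: T5 => //.
    by rewrite -cd2 cd1.
  - move=> c d cd1 cd2; rewrite !ffunE -cd1; apply: T6 => //.
    by rewrite cd1.
  - by move=> c; rewrite ffunE; split; [apply: T3|apply: T4].
rewrite /Grow fillE fps_sum_image.
  apply: eq_fps_sum => T _; rewrite /= /wt /array_wt.
  (* The product over the subtype of cells passes through a product over a rectangle to become a
     product over rows. *)
  transitivity (\prod_(p : 'I_n * 'I_(\max_i lambda i).+1 | in_shape lambda mu p.1 p.2)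
    cell_wt p.1 p.2 (T p.1 p.2)).
    rewrite (reindex_omap (val : cell lambda mu -> _) insub) => [|p pP]; last first.
      by rewrite insubT.
    apply: eq_big => [c|c _]; last by rewrite ffunE.
    by rewrite valK eqxx andbT; apply/esym/cellP.
  rewrite (eq_bigr (fun i : 'I_n => \prod_(j < (\max_i lambda i).+1 | in_shape lambda mu i j)
      cell_wt i j (T i j))); first by rewrite pair_big_dep.
  move=> i _; rewrite (big_nat_widen _ _ (\max_i lambda i).+1); last first.
    by rewrite ltnS leq_bigmax.
  by rewrite big_geq_mkord; apply: eq_bigl => j; rewrite /in_shape /= ltnS andbC.
move=> T U /set_mem[T1 _ _ _ _ _] /set_mem[U1 _ _ _ _ _] /ffunP TU.
apply/funext => i; apply/funext => j.
have [/ex_cell[c [<- <-]]|nsh] := boolP (in_shape lambda mu i j); last first.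
  by rewrite T1 // U1.
by have := TU c; rewrite !ffunE.
Qed.

Lemma cell_wt_ord i j c : ord_ge (size c) (cell_wt i j c).
Proof.
rewrite /cell_wt -[size c]addn0 -[(size c + 0)%N]addn0.
apply: ord_geM (ord_ge0 _); apply: ord_geM (ord_ge0 _).
rewrite -sum1_size; apply: ord_ge_prod => p; exact: ord_geX.
Qed.

(** The number of elements bounds the degree from below, and the flags bound the elements, so each
    degree admits finitely many arrays. *)
Lemma arrays_summable lambda mu r s :
  summable (arrays lambda mu r s) (array_wt lambda mu).
Proof.
pose size_of T := (\sum_i \sum_((mu i).+1 <= j < (lambda i).+1) size (T i j))%N.
apply: (@ord_ge_summable _ _ _ _ _ size_of) => [T _|d].
  by apply: ord_ge_prod => i; apply: ord_ge_prod => j; apply: cell_wt_ord.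
pose L := (\max_i lambda i)%N.
have [cs csP] := finite_bounded_marked_seqs d (\max_i s i).
(* The extra index [size cs] makes [nth] return its default [[::]], the value outside the shape. *)
pose build (g : {ffun 'I_n * 'I_L.+1 -> 'I_(size cs).+1}) : array :=
  fun i j => if (j <= L)%N then nth [::] cs (g (i, inord j)) else [::].
apply: (@sub_finite_set _ _ (range build)); last exact: finite_image.
move=> T [TA /= Td]; have small i j : T i j = [::] \/ T i j \in cs.
  have [sh|] := boolP (in_shape lambda mu i j); last first.
    by move=> /(array_out TA); left.
  right; apply: csP.
    apply: leq_trans Td; rewrite /size_of (bigD1 i) //=.
    rewrite (bigD1_seq j) ?iota_uniq ?mem_index_iota //=; first by lia.
  have := all_le_maxm (array_cell TA sh); apply: sub_all => p pm.
  by apply: leq_trans pm _; apply: leq_trans (array_max TA sh) (leq_bigmax i).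
exists [ffun p : 'I_n * 'I_L.+1 => inord (index (T p.1 p.2) cs)] => //.
apply/funext => i; apply/funext => j; rewrite /build.
have [jL|Lj] := leqP j L; last first.
  rewrite (array_out TA) //; apply/negP => /andP[_].
  by rewrite leqNgt (leq_ltn_trans _ Lj) // /L leq_bigmax.
rewrite ffunE /= inordK // inordK ?ltnS ?index_size //.
have [-> |/nth_index -> //] := small i j.
have [ics|] := boolP ([::] \in cs); first by rewrite nth_index.
by rewrite -index_mem -leqNgt => ?; rewrite nth_default.
Qed.

Definition decr (f : 'I_n -> nat) i : 'I_n -> nat :=
  fun k => if k == i then (f i).-1 else f k.

Definition upd T i j (c : marked_seq) : array :=
  fun i' j' => if (i' == i) && (j' == j) then c else T i' j'.

Lemma upd_same T i j c : upd T i j c i j = c.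
Proof. by rewrite /upd !eqxx. Qed.

Lemma upd_id T i j : upd T i j (T i j) = T.
Proof.
apply/funext => k; apply/funext => l; rewrite /upd.
by case: ifP => // /andP[/eqP -> /eqP ->].
Qed.

Lemma upd_upd T i j c c' : upd (upd T i j c) i j c' = upd T i j c'.
Proof.
by apply/funext => k; apply/funext => l; rewrite /upd; case: (_ && _).
Qed.

(** The last cell of a row carries its maximum, so lowering the flag of the row constrains that cell
    alone. *)
Lemma array_row_mono lambda mu r s T i j : is_array lambda mu r s T ->
  in_shape lambda mu i j -> (maxm (T i j) <= maxm (T i (lambda i)))%N.
Proof.
move=> TA /andP[mj]; move: {2}(_ - j)%N (erefl (lambda i - j)%N) => d.
elim: d j mj => [|d IH] j mj dE jl.
  by rewrite (_ : j = lambda i) //; lia.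
have sh : in_shape lambda mu i j by rewrite /in_shape mj.
have sh1 : in_shape lambda mu i j.+1 by rewrite /in_shape; lia.
apply: leq_trans (array_row TA sh sh1) _.
apply: leq_trans (minm_le_maxm (array_cell TA sh1)) _.
by apply: IH; lia.
Qed.

Lemma array_decr_flag lambda mu r s T i : (mu i < lambda i)%N -> (0 < s i)%N ->
  is_array lambda mu r (decr s i) T <->
  is_array lambda mu r s T /\ (maxm (T i (lambda i)) < s i)%N.
Proof.
move=> ml s0; have shi : in_shape lambda mu i (lambda i) by rewrite /in_shape ml leqnn.
split=> [TA|[TA ms]].
  have := array_max TA shi; rewrite /decr eqxx => ms; split; last by lia.
  case: TA => T1 T2 T3 T4 T5 T6; split=> // k j /T4; rewrite /decr.
  by case: eqP => // ->; lia.
have mono j := @array_row_mono _ _ _ _ _ i j TA.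
case: TA => T1 T2 T3 T4 T5 T6; split=> // k j sh; have := T4 _ _ sh.
rewrite /decr; case: eqP => // ki _; rewrite ki in sh *.
have := mono j sh; lia.
Qed.

Lemma array_wt_upd lambda mu T i c : (mu i < lambda i)%N ->
  array_wt lambda mu (upd T i (lambda i) c) =
  cell_wt i (lambda i) c * array_wt (decr lambda i) mu T.
Proof.
move=> ml; rewrite /array_wt (bigD1 i) //= [in RHS](bigD1 i) //=.
have -> : \prod_((mu i).+1 <= j < (lambda i).+1)
      cell_wt i j (upd T i (lambda i) c i j) =
    cell_wt i (lambda i) c *
    \prod_((mu i).+1 <= j < (decr lambda i i).+1) cell_wt i j (T i j).
  rewrite /decr eqxx prednK ?(leq_ltn_trans _ ml) // big_nat_recr //= upd_same mulrC.
  congr (_ * _); apply: eq_big_nat => j /andP[_ jl]; rewrite /upd eqxx /=.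
  by rewrite ltn_eqF.
rewrite -mulrA (eq_bigr (fun k => \prod_((mu k).+1 <= j < (decr lambda i k).+1)
  cell_wt k j (T k j))) // => k ki.
rewrite /decr (negPf ki); apply: eq_bigr => j _.
by rewrite /upd (negPf ki).
Qed.

End Arrays.

(** * The corner recursion *)

Section CellWeights.
Implicit Types (i j v : nat) (c : marked_seq).

Lemma cell_wt_seq1 i j v : cell_wt i j [:: (v, false)] = x_ v.
Proof. by rewrite /cell_wt big_seq1 /= !expr0 !mulr1. Qed.

(** A marked multiset has an unmarked element, so the truncated exponent [(unmarked c).-1] really
    grows by one. *)
Lemma cell_wt_rcons_unmarked i j v c : marked_multiset c ->
  cell_wt i j (rcons c (v, false)) = x_ v * (alpha_ j * cell_wt i j c).
Proof.
move=> /unmarked_gt0 uc; rewrite /cell_wt big_rcons /= unmarked_rcons marked_rcons /=.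
rewrite addn0 addn1 /= -[in LHS](prednK uc) exprS.
by move: (x_ v) (alpha_ j) (alpha_ j ^+ _) (_ ^+ marked c) => x a a' b; ring.
Qed.

Lemma cell_wt_rcons_marked i j v c :
  cell_wt i j (rcons c (v, true)) = x_ v * - (beta_ i.+1 * cell_wt i j c).
Proof.
rewrite /cell_wt big_rcons /= unmarked_rcons marked_rcons /= addn0 addn1 exprS.
by move: (x_ v) (alpha_ j ^+ _) (beta_ _) (_ ^+ marked c) => x a b b'; ring.
Qed.

End CellWeights.

Section Corner.
Variables (n : nat) (lambda mu r s : 'I_n -> nat) (i : 'I_n).
Hypotheses (mu_lt : (mu i < lambda i)%N)
  (corner : forall k : 'I_n, k = i.+1 :> nat -> (lambda k < lambda i)%N).
Implicit Types (T : array n) (c : marked_seq).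

Let l := lambda i.
Let lambda' := decr lambda i.

(** All conditions that involve the corner cell: in the shape it can have neighbours only on its
    left and above it. *)
Definition placeable T c :=
  [/\ marked_multiset c, (r i <= minm c)%N, (maxm c <= s i)%N,
    in_shape lambda mu i l.-1 -> (maxm (T i l.-1) <= minm c)%N &
    forall k : 'I_n, i = k.+1 :> nat -> in_shape lambda mu k l ->
      (maxm (T k l) < minm c)%N].

Lemma placeable_upd T c c' : placeable (upd T i l c') c <-> placeable T c.
Proof.
rewrite /placeable; have -> : upd T i l c' i l.-1 = T i l.-1.
  rewrite /upd eqxx ltn_eqF // prednK //; exact: leq_ltn_trans mu_lt.
have E (k : 'I_n) : i = k.+1 :> nat -> upd T i l c' k l = T k l.
  by move=> ik; rewrite /upd -val_eqE /= ik ltn_eqF.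
by split=> -[? ? ? ? H]; split=> // k ik; have := H k ik; rewrite E.
Qed.

Lemma in_shape_decr (k : 'I_n) j :
  in_shape lambda' mu k j = in_shape lambda mu k j && ~~ ((k == i) && (j == l)).
Proof.
rewrite /in_shape /lambda' /decr; case: eqP => [->|_]; last by rewrite andbT.
rewrite -/l /=; move: mu_lt; rewrite -/l; lia.
Qed.

(** An array splits into the array without the corner and an admissible content for the corner. *)
Lemma array_cornerP T :
  is_array lambda mu r s T <->
  is_array lambda' mu r s (upd T i l [::]) /\ placeable T (T i l).
Proof.
have shc : in_shape lambda mu i l by rewrite /in_shape mu_lt leqnn.
have updE (k : 'I_n) j : ~~ ((k == i) && (j == l)) -> upd T i l [::] k j = T k j.
  by rewrite /upd => /negPf ->.
have updE' (k : 'I_n) j : in_shape lambda' mu k j -> upd T i l [::] k j = T k j.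
  by rewrite in_shape_decr => /andP[_ /updE].
have sub (k : 'I_n) j : in_shape lambda' mu k j -> in_shape lambda mu k j.
  by rewrite in_shape_decr => /andP[].
have sup (k : 'I_n) j : in_shape lambda mu k j -> ~~ ((k == i) && (j == l)) ->
    in_shape lambda' mu k j by rewrite in_shape_decr => -> ->.
split=> [TA|[[T1 T2 T3 T4 T5 T6] [c1 c2 c3 c4 c5]]].
  split.
    case: TA => T1 T2 T3 T4 T5 T6; split.
    - move=> k j; rewrite in_shape_decr negb_and negbK.
      by rewrite /upd; case: ifP => // _; rewrite orbF; apply: T1.
    - by move=> k j sh; rewrite updE' //; apply/T2/sub.
    - by move=> k j sh; rewrite updE' //; apply/T3/sub.
    - by move=> k j sh; rewrite updE' //; apply/T4/sub.
    - by move=> k j sh sh'; rewrite !updE' //; apply: T5; apply: sub.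
    - by move=> k k' j kk sh sh'; rewrite !updE' //; apply: T6 => //; apply: sub.
  split; [exact: (array_cell TA shc) | exact: (array_min TA shc) | exact: (array_max TA shc) | |].
    have l0 : l.-1.+1 = l by rewrite prednK //; apply: leq_ltn_trans mu_lt.
    by move=> sh; have := array_row TA sh; rewrite l0; apply.
  by move=> k ik sh; apply: (array_col TA ik).
split.
- move=> k j nsh; have [/andP[/eqP ki /eqP jl]|ncor] := boolP ((k == i) && (j == l)).
    by rewrite ki jl shc in nsh.
  by rewrite -updE //; apply: T1; rewrite in_shape_decr (negPf nsh).
- move=> k j sh; have [/andP[/eqP -> /eqP ->] //|ncor] := boolP ((k == i) && (j == l)).
  by rewrite -updE //; apply/T2/sup.
- move=> k j sh; have [/andP[/eqP -> /eqP ->] //|ncor] := boolP ((k == i) && (j == l)).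
  by rewrite -updE //; apply/T3/sup.
- move=> k j sh; have [/andP[/eqP -> /eqP ->] //|ncor] := boolP ((k == i) && (j == l)).
  by rewrite -updE //; apply/T4/sup.
- move=> k j sh sh'; have ncor' : ~~ ((k == i) && (j == l)).
    apply/negP => /andP[/eqP ki /eqP jl]; move: sh'; rewrite ki jl /in_shape -/l.
    by rewrite ltnn andbF.
  have [/andP[/eqP ki /eqP jl]|ncor] := boolP ((k == i) && (j.+1 == l)).
    have jE : j = l.-1 by rewrite -jl.
    by rewrite ki jl jE; apply: c4; rewrite -jE -ki.
  by rewrite -!updE //; apply: T5; apply: sup.
(* The corner cannot be the upper cell of a vertical pair, by [corner]. *)
move=> k k' j kk sh sh'; have ncor' : ~~ ((k == i) && (j == l)).
  apply/negP => /andP[/eqP ki /eqP jl]; rewrite ki in kk.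
  by case/andP: sh' => _; rewrite jl leqNgt (corner kk).
have [/andP[/eqP ki /eqP jl]|ncor] := boolP ((k' == i) && (j == l)).
  by rewrite ki jl; apply: c5; [rewrite -ki | rewrite -jl].
by rewrite -!updE //; apply: (T6 _ _ _ kk); apply: sup.
Qed.

Hypotheses (r_gt0 : (0 < r i)%N) (r_le_s : (r i <= s i)%N)
  (above : forall k : 'I_n, i = k.+1 :> nat -> (mu k < lambda i)%N -> (s k < s i)%N).

Let s' := decr s i.
Let s_gt0 : (0 < s i)%N := leq_trans r_gt0 r_le_s.

(** On an array of shape [lambda'] the corner is empty, so the same operation also creates the
    singleton cell. *)
Definition app_corner b T := upd T i l (rcons (T i l) (s i, b)).

Lemma app_corner_inj b (A : set (array n)) : set_inj A (app_corner b).
Proof.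
move=> T U _ _ TU; rewrite -(upd_id T i l) -(upd_id U i l).
have -> : T i l = U i l.
  have := congr1 (fun V : array n => V i l) TU.
  by rewrite /app_corner !upd_same => /rcons_inj[].
have := congr1 (fun V => upd V i l (U i l)) TU.
by rewrite /app_corner !upd_upd.
Qed.

Lemma placeable_rcons T c (b : bool) : placeable T c -> (b -> maxm c < s i)%N ->
  placeable T (rcons c (s i, b)).
Proof.
move=> [c1 c2 c3 c4 c5] cb; have c0 := marked_multiset_neq0 c1.
split; rewrite ?minm_rcons ?maxm_rcons //.
by rewrite marked_multiset_rcons // c1 /= s_gt0 c3; apply/implyP.
Qed.

Lemma placeable_belast T c p : c != [::] -> placeable T (rcons c p) ->
  [/\ placeable T c, (p.1 <= s i)%N & p.2 -> (maxm c < p.1)%N].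
Proof.
move=> c0 []; rewrite marked_multiset_rcons // minm_rcons // maxm_rcons.
move=> /and4P[c1 _ cp /implyP pc] c2 ps c4 c5; split=> //; split=> //.
exact: leq_trans cp ps.
Qed.

Lemma app_corner_array (b : bool) T : is_array lambda mu r s T ->
  (b -> maxm (T i l) < s i)%N -> is_array lambda mu r s (app_corner b T).
Proof.
move=> /array_cornerP[TL Tc] Tb; apply/array_cornerP.
rewrite /app_corner upd_upd upd_same; split=> //.
exact/placeable_upd/placeable_rcons.
Qed.

(** The singleton fits: the flag of the row bounds the left neighbour by [s i], and [above] makes
    the upper neighbour strictly smaller. *)
Lemma app_corner_shorter T : is_array lambda' mu r s T ->
  is_array lambda mu r s (app_corner false T).
Proof.
move=> TL; have T0 : T i l = [::].
  by rewrite (array_out TL) // in_shape_decr !eqxx andbF.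
apply/array_cornerP; rewrite /app_corner upd_upd upd_same T0 -[in upd T _ _ _]T0 upd_id.
split=> //; apply/placeable_upd; split=> //=.
- by rewrite s_gt0.
- move=> sh; rewrite /minm /=; apply: (array_max TL).
  rewrite in_shape_decr sh eqxx ltn_eqF // prednK //; exact: leq_ltn_trans mu_lt.
move=> k ik sh; apply: leq_ltn_trans (above ik _); last by case/andP: sh.
by apply: (array_max TL); rewrite in_shape_decr sh -val_eqE /= ik ltn_eqF.
Qed.

(** A marked element strictly exceeds its predecessor, so deleting a marked [s i] leaves an array
    with flag [s']. An unmarked one may repeat its predecessor, and deleting it leaves the flag at
    [s]. *)
Lemma arrays_corner :
  (arrays lambda mu r s = arrays lambda mu r s' `|`
    (app_corner false @` arrays lambda' mu r s `|`
    (app_corner false @` arrays lambda mu r s `|`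
     app_corner true @` arrays lambda mu r s')))%classic.
Proof.
apply/seteqP; split=> T; last first.
  case=> [|[[U UA <-]|[[U UA <-]|[U UA <-]]]].
  - by move=> /(array_decr_flag _ _ mu_lt s_gt0)[].
  - exact: app_corner_shorter.
  - exact: app_corner_array.
  by move: UA => /(array_decr_flag _ _ mu_lt s_gt0)[UA Us]; apply: app_corner_array.
move=> TA; have [ms|sv] := ltnP (maxm (T i l)) (s i).
  by left; apply/array_decr_flag.
have /array_cornerP[TL Tc] := TA; right.
case/lastP E : (T i l) Tc sv => [|c [v b]]; first by case.
rewrite maxm_rcons /= => Tc sv.
have {sv} vs : v = s i.
  by apply/eqP; rewrite eqn_leq sv andbT; case: Tc; rewrite maxm_rcons.
rewrite {v}vs in E Tc.
have TE : T = app_corner b (upd T i l c) by rewrite /app_corner upd_upd upd_same -E upd_id.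
have [c0|c0] := eqVneq c [::].
  left; exists (upd T i l [::]) => //.
  case: Tc; rewrite c0 marked_multiset_seq1 => /andP[_ /negPf /= b0] _ _ _ _.
  by rewrite [RHS]TE b0 c0.
have [cT _ cb] := placeable_belast c0 Tc.
have UA : is_array lambda mu r s (upd T i l c).
  by apply/array_cornerP; rewrite upd_upd upd_same; split=> //; apply/placeable_upd.
right; case: b E Tc TE cb => E Tc TE cb; [right|left]; exists (upd T i l c) => //.
by apply/array_decr_flag => //; rewrite upd_same; split=> //; apply: cb.
Qed.

Lemma array_sum_corner :
  array_sum lambda mu r s = array_sum lambda mu r s' +
    (x_ (s i) * array_sum lambda' mu r s +
    (x_ (s i) * (alpha_ l * array_sum lambda mu r s) +
     x_ (s i) * - (beta_ i.+1 * array_sum lambda mu r s'))).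
Proof.
have sA := arrays_summable lambda mu r s.
have sB := arrays_summable lambda mu r s'.
have wtE T : array_wt lambda mu T = cell_wt i l (T i l) * array_wt lambda' mu T.
  by rewrite -{1}(upd_id T i l) array_wt_upd.
have last_app b T : last (0%N, false) (app_corner b T i l) = (s i, b).
  by rewrite /app_corner upd_same last_rcons.
have max_app b T : maxm (app_corner b T i l) = s i.
  by rewrite /app_corner upd_same maxm_rcons.
rewrite [LHS]/array_sum arrays_corner.
have sub4 : summable (arrays lambda mu r s' `|`
    (app_corner false @` arrays lambda' mu r s `|`
    (app_corner false @` arrays lambda mu r s `|`
     app_corner true @` arrays lambda mu r s')))%classic (array_wt lambda mu).
  by rewrite -arrays_corner.
rewrite fps_sumU //; last first.
  (* The first piece has corner maximum below [s i], the other three have it equal to [s i]. *)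
  move=> T [/(array_decr_flag _ _ mu_lt s_gt0)[_ Ts]].
  by case=> [|[|]] [U _ UT]; move: Ts; rewrite -UT max_app ltnn.
congr (_ + _).
have sub3 := sub_summable (@subsetUr _ _ _) sub4.
rewrite fps_sumU //; last first.
  move=> T [[U UL <-] [] [V VA]]; last first.
    by move=> /(congr1 (fun W : array n => last (0%N, false) (W i l))); rewrite !last_app.
  (* A common preimage would have the corner both empty and nonempty. *)
  move=> /(@app_corner_inj _ setT) VU; rewrite VU ?inE // in VA.
  have := array_cell VA (_ : in_shape lambda mu i l).
  rewrite (array_out UL) ?in_shape_decr ?eqxx ?andbF // => /(_ _)/negP; apply=> //.
  by rewrite /in_shape mu_lt leqnn.
have sub2 := sub_summable (@subsetUr _ _ _) sub3.
rewrite fps_sumU //; last first.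
  move=> T [[U _ <-] [V _]].
  by move=> /(congr1 (fun W : array n => last (0%N, false) (W i l))); rewrite !last_app.
rewrite !fps_sum_image; try exact: app_corner_inj.
have addE (a b c a' b' c' : series) : a = a' -> b = b' -> c = c' ->
  a + (b + c) = a' + (b' + c') by move=> -> -> ->.
apply: addE.
- transitivity (fps_sum (arrays lambda' mu r s)
    (fun T => x_ (s i) * array_wt lambda' mu T)); last exact: fps_sumXM.
  apply: eq_fps_sum => T TL; rewrite [LHS]array_wt_upd // (array_out TL).
    by rewrite cell_wt_seq1.
  by rewrite in_shape_decr !eqxx andbF.
- transitivity (fps_sum (arrays lambda mu r s)
    (fun T => x_ (s i) * (alpha_ l * array_wt lambda mu T))); last first.
    by etransitivity; [exact: fps_sumXM | apply: congr1; exact: fps_sumXM].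
  apply: eq_fps_sum => T TA; rewrite [LHS]array_wt_upd //.
  have mulE (a c w w' x y : series) : a = x * (y * c) -> w = c * w' ->
    a * w' = x * (y * w) by move=> -> ->; ring.
  apply: (mulE _ (cell_wt i l (T i l))); last exact: wtE.
  apply: cell_wt_rcons_unmarked.
  by apply: (array_cell TA); rewrite /in_shape mu_lt leqnn.
transitivity (fps_sum (arrays lambda mu r s')
  (fun T => x_ (s i) * - (beta_ i.+1 * array_wt lambda mu T))).
  apply: eq_fps_sum => T _; rewrite [LHS]array_wt_upd //.
  have mulE (a c w w' x y : series) : a = x * - (y * c) -> w = c * w' ->
    a * w' = x * - (y * w) by move=> -> ->; ring.
  apply: (mulE _ (cell_wt i l (T i l))); last exact: wtE.
  exact: cell_wt_rcons_marked.
etransitivity; first exact: fps_sumXM.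
apply: congr1; etransitivity; first by apply: fps_sumN; apply: summableXM.
by apply: congr1; exact: fps_sumXM.
Qed.

End Corner.

(** * The Jacobi-Trudi identity *)

(** Each use of the equation raises the order by one, so the order is unbounded. This takes the
    place of dividing by [1 - v g]. *)
Lemma fixpoint_XM_eq0 (I : choiceType) (R : comNzRingType) (v : I) (f g : fps I R) :
  f = fpsX R v * (g * f) -> f = 0.
Proof.
move=> fE; have fk k : ord_ge k f.
  elim: k => [|k IH]; first exact: ord_ge0.
  by rewrite fE -add1n; apply: ord_geM (ord_geX _ _) _; apply: ord_geMl.
by apply: fpsP => m; rewrite (fk (mdeg m).+1) //= if_same.
Qed.

Section JacobiTrudi.
Variable n : nat.
Implicit Types (lambda mu r s : 'I_n -> nat) (i j k : 'I_n).

Definition jt_matrix lambda mu r s : 'M[series]_n :=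
  \matrix_(i, j) jt_entry (lambda i) (mu j) i j (r j) (s i).

Definition jt_const r s : series :=
  \prod_(i < n) \prod_(r i <= l < (s i).+1) (1 - beta_ i.+1 * x_ l).

Definition flag_compatible lambda mu (f : 'I_n -> nat) :=
  forall i j, j = i.+1 :> nat -> (mu i < lambda j)%N -> (f i <= f j)%N.

Lemma decr_le (f : 'I_n -> nat) i k : (decr f i k <= f k)%N.
Proof. by rewrite /decr; case: eqP => // ->; apply: leq_pred. Qed.

Lemma sum_decr (f : 'I_n -> nat) i : (0 < f i)%N ->
  (\sum_k decr f i k < \sum_k f k)%N.
Proof.
move=> fi; rewrite (bigD1 i) //= [X in (_ < X)%N](bigD1 i) //= /decr eqxx.
rewrite (eq_bigr f) => [|k /negPf -> //].
by rewrite -addSn prednK.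
Qed.

Lemma array_sum_empty lambda mu r s : (forall i, lambda i = mu i) ->
  array_sum lambda mu r s = 1.
Proof.
move=> lm; have nsh i (l : nat) : ~~ in_shape lambda mu i l.
  by rewrite /in_shape lm; lia.
have arrE : arrays lambda mu r s = [set (fun _ _ => [::])]%classic.
  apply/seteqP; split=> [T TA | _ ->] /=.
    by apply/funext => i; apply/funext => j; by apply: (array_out TA); apply: nsh.
  by split=> // i j; rewrite ?(negPf (nsh _ _)) // => k _; rewrite (negPf (nsh _ _)).
apply: fpsP => m; rewrite /array_sum arrE [LHS]fsbig_set1 /array_wt.
by rewrite big1 // => i _; rewrite lm big_geq.
Qed.

Lemma array_sum_eq0 lambda mu r s i : (mu i < lambda i)%N -> (s i < r i)%N ->
  array_sum lambda mu r s = 0.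
Proof.
move=> ml sr; apply: fps_sum0 => T TA; have sh : in_shape lambda mu i (lambda i).
  by rewrite /in_shape ml leqnn.
have := minm_le_maxm (array_cell TA sh).
by have := array_min TA sh; have := array_max TA sh; lia.
Qed.

(** The cell below the last cell of row [i] is bounded by the same flag and strictly larger, so the
    last cell of row [i] never reaches [s i]. *)
Lemma array_sum_flag_pred lambda mu r s i k : is_partition mu ->
    k = i.+1 :> nat -> (mu i < lambda i)%N -> lambda k = lambda i ->
    s k = s i -> (0 < s i)%N ->
  array_sum lambda mu r s = array_sum lambda mu r (decr s i).
Proof.
move=> muP ki ml lk sk s0; rewrite /array_sum.
suff -> : arrays lambda mu r (decr s i) = arrays lambda mu r s by [].
apply/seteqP; split=> T; first by move=> /(array_decr_flag _ _ ml s0)[].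
move=> TA; apply/(array_decr_flag _ _ ml s0); split=> //.
have sh : in_shape lambda mu i (lambda i) by rewrite /in_shape ml leqnn.
have shk : in_shape lambda mu k (lambda i).
  by rewrite /in_shape lk leqnn andbT (leq_ltn_trans _ ml) // muP // ki.
apply: leq_trans (array_col TA ki sh shk) _; rewrite -sk.
exact: leq_trans (minm_le_maxm (array_cell TA shk)) (array_max TA shk).
Qed.

Lemma jt_lower_zero lambda mu r s (k : nat) :
    (forall i j, (j <= k < i)%N -> (lambda i <= mu j)%N) ->
  lower_zero (jt_matrix lambda mu r s) k.
Proof.
move=> lm i j /andP[jk ki]; rewrite mxE jt_entry_low //.
  exact: leq_ltn_trans ki.
by apply: lm; rewrite jk.
Qed.

(** One break between consecutive rows propagates by monotonicity to the whole lower left block. *)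
Lemma break_le lambda mu i k : is_partition lambda -> is_partition mu ->
    k = i.+1 :> nat -> (lambda k <= mu i)%N ->
  forall a b : 'I_n, (b <= i < a)%N -> (lambda a <= mu b)%N.
Proof.
move=> lP mP ki lm a b /andP[bi ia].
by apply: leq_trans (mP _ _ bi); apply: leq_trans lm; apply: lP; rewrite ki.
Qed.

(** Without a break between [i] and [j], the flag inequalities of consecutive rows chain
    together. *)
Lemma break_or_flags lambda mu (f : 'I_n -> nat) i j :
    flag_compatible lambda mu f -> (i <= j)%N ->
  (exists k k', [/\ (i <= k < j)%N, k' = k.+1 :> nat & (lambda k' <= mu k)%N]) \/
  (f i <= f j)%N.
Proof.
move=> fP; move: {2}(j - i)%N (erefl (j - i)%N) => d.
elim: d j => [|d IH] j jd ij.
  by right; rewrite (_ : i = j) //; apply: val_inj => /=; lia.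
have jn : (j.-1 < n)%N by apply: leq_ltn_trans (ltn_ord j); lia.
pose j' := Ordinal jn; have jj : j = j'.+1 :> nat by rewrite /=; lia.
have [le|lt] := leqP (lambda j) (mu j').
  by left; exists j', j; split=> //=; lia.
have [||[k [k' [ik kk lk]]]|fij] := IH j'; rewrite /=; try lia.
  by left; exists k, k'; split=> //; move: ik => /=; lia.
by right; apply: leq_trans fij _; apply: fP jj lt.
Qed.

(** For rows [a] and columns [b] with a <= i <= b and no break between them, s_a <= s_i < r_i <=
    r_b. The interval of x's is then empty while the index is positive, so the entry is 0. *)
Lemma det_jt_eq0 lambda mu r s i : is_partition lambda -> is_partition mu ->
    flag_compatible lambda mu r -> flag_compatible lambda mu s ->
    (mu i < lambda i)%N -> (s i < r i)%N ->
  \det (jt_matrix lambda mu r s) = 0.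
Proof.
move=> lP mP rP sP ml sr; apply: (@det_eq0_upto_lower_zero _ _ _ i) => a b /andP[ai ib].
have brk k k' : (a <= k < b)%N -> k' = k.+1 :> nat -> (lambda k' <= mu k)%N ->
    exists2 k : nat, (a <= k < b)%N & lower_zero (jt_matrix lambda mu r s) k.
  move=> akb kk lm; exists k => //; apply: jt_lower_zero; exact: (break_le lP mP kk lm).
have [[k [k' [aki kk lm]]]|sai] := break_or_flags sP ai.
  by right; apply: (brk k k') => //; lia.
have [[k [k' [ikb kk lm]]]|rib] := break_or_flags rP ib.
  by right; apply: (brk k k') => //; lia.
left; rewrite mxE jt_entry_empty //; first by lia.
  exact: leq_trans ib.
by apply: leq_ltn_trans (mP _ _ ib) _; apply: leq_trans ml (lP _ _ ai).
Qed.

(** The matrix is upper triangular, and its diagonal entries are the inverses of the factors of the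
    constant. *)
Lemma jt_empty lambda mu r s : is_partition mu -> (forall i, lambda i = mu i) ->
  (forall i, (0 < r i)%N) -> jt_const r s * \det (jt_matrix lambda mu r s) = 1.
Proof.
move=> mP lm r0; rewrite -det_tr det_trig; last first.
  apply/is_trig_mxP => i j ij; rewrite !mxE jt_entry_low // lm.
  by apply: mP; apply: ltnW.
rewrite /jt_const -big_split /= big1 // => i _.
by rewrite !mxE lm jt_entry_diag.
Qed.

Lemma det_jt_flag_pred lambda mu r s i : is_partition lambda -> is_partition mu ->
    (mu i < lambda i)%N -> (0 < s i)%N ->
    (forall j, (mu j < lambda j)%N -> (r j <= s i)%N) ->
  \det (jt_matrix lambda mu r (decr s i)) =
    (1 - x_ (s i) * alpha_ (lambda i)) * \det (jt_matrix lambda mu r s)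
    + (- x_ (s i)) * \det (jt_matrix (decr lambda i) mu r s).
Proof.
move=> lP mP ml s0 rs.
(* [N] has exactly the determinant on the right, by linearity in row [i]; it is then compared
   entrywise with the matrix on the left. *)
pose N := \matrix_(a, b) if a == i then
    (1 - x_ (s i) * alpha_ (lambda i)) * jt_matrix lambda mu r s i b
    + (- x_ (s i)) * jt_matrix (decr lambda i) mu r s i b
  else jt_matrix lambda mu r s a b.
have rowE a b : a != i -> jt_matrix lambda mu r (decr s i) a b = jt_matrix lambda mu r s a b.
  by move=> /negPf ai; rewrite !mxE /decr ai.
have rowE' a b : a != i -> jt_matrix (decr lambda i) mu r s a b = jt_matrix lambda mu r s a b.
  by move=> /negPf ai; rewrite !mxE /decr ai.
rewrite -(@determinant_multilinear _ _ N _ _ i); last 3 first.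
- by apply/rowP => b; rewrite !mxE eqxx.
- by apply/matrixP => a b; rewrite [RHS]mxE [LHS]mxE [RHS]mxE eq_sym (negPf (neq_lift i a)).
- apply/matrixP => a b; rewrite [RHS]mxE [LHS]mxE [RHS]mxE eq_sym (negPf (neq_lift i a)).
  by rewrite rowE' // eq_sym neq_lift.
apply: det_eq_upto_lower_zero => a b; rewrite [N a b]mxE.
case: eqP => [-> {a}|/eqP ai]; last by left; apply: rowE.
have l0 : (lambda i).-1.+1 = lambda i by rewrite prednK // (leq_ltn_trans _ ml).
have [rb|rb] := leqP (r b) (s i).
  (* The entry recurrence applies when [x_ (s i)] lies in the interval starting at [r b]; in the
     remaining columns row [b] of the shape is empty. *)
  left; rewrite !mxE /decr eqxx; have := @jt_entry_flag_pred (lambda i).-1 (mu b) i b (r b) (s i).-1.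
  by rewrite l0 prednK //; apply.
have mb : (lambda b <= mu b)%N.
  by rewrite leqNgt; apply/negP => /rs; rewrite leqNgt rb.
have [ib|bi|/val_inj bi] := ltngtP i b; last by rewrite -bi leqNgt ml in mb.
(* An empty row [b] below row [i] gives a break just before [b], so the entry lies in an irrelevant
   upper right block. *)
- right; exists b.-1; first by lia.
  have low (a c : 'I_n) : (c <= b.-1 < a)%N -> (lambda a <= mu c)%N.
    move=> cba; apply: leq_trans (lP b a _) _; first by lia.
    by apply: leq_trans mb _; apply: mP; lia.
  split; first exact: jt_lower_zero.
  move=> a c cba; rewrite mxE ifN; first exact: jt_lower_zero cba.
  by rewrite -val_eqE /=; lia.
(* For an empty row [b] above row [i], all three entries lie below the diagonal and vanish. *)
left; have lim : (lambda i <= mu b)%N by apply: leq_trans mb; apply: lP; apply: ltnW.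
rewrite !mxE !jt_entry_low ?mulr0 ?addr0 //.
by rewrite /decr eqxx (leq_trans (leq_pred _)).
Qed.

Lemma det_jt_equal_rows lambda mu r s i k : k = i.+1 :> nat ->
    lambda k = lambda i -> s k = s i -> (0 < lambda i)%N ->
  \det (jt_matrix (decr lambda i) mu r s) =
    (beta_ i.+1 - alpha_ (lambda i)) * \det (jt_matrix lambda mu r s).
Proof.
move=> ki lk sk l0; have ik : i != k by rewrite -val_eqE /= ki; lia.
apply: (det_row_add ik) => [b|a b /negPf ai]; last by rewrite !mxE /decr ai.
rewrite !mxE /decr eqxx eq_sym (negPf ik) lk sk ki.
by have := jt_entry_next_row (lambda i).-1 (mu b) i b (r b) (s i); rewrite prednK.
Qed.

Lemma jt_const_flag_pred r s i : (r i <= s i)%N -> (0 < s i)%N ->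
  jt_const r s = (1 - beta_ i.+1 * x_ (s i)) * jt_const r (decr s i).
Proof.
move=> rs s0; rewrite /jt_const (bigD1 i) //= [in RHS](bigD1 i) //= mulrA.
have -> : \prod_(r i <= l < (s i).+1) (1 - beta_ i.+1 * x_ l) =
    (1 - beta_ i.+1 * x_ (s i)) *
    \prod_(r i <= l < (decr s i i).+1) (1 - beta_ i.+1 * x_ l).
  by rewrite /decr eqxx prednK // big_nat_recr //= mulrC.
by apply: congr1; apply: eq_bigr => k /negPf ki; rewrite /decr ki.
Qed.

(** Ties go to the smallest index, which makes the flag strictly smaller in the rows above that
    satisfy [P]. *)
Lemma topmost_maximal_row (P : pred 'I_n) (f : 'I_n -> nat) i0 : P i0 ->
  exists2 i, P i & forall k, P k -> (f k < f i)%N \/ f k = f i /\ (i <= k)%N.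
Proof.
move=> P0; case: (arg_maxnP f P0) => i1 P1 max1.
have Q1 : P i1 && (f i1 == f i1) by rewrite P1 eqxx.
case: (arg_minnP (P := fun i => P i && (f i == f i1)) val Q1) => i /andP[Pi /eqP fi] mini.
exists i => // k Pk; rewrite fi; have [lt|ge] := ltnP (f k) (f i1); first by left.
have fk : f k = f i1 by apply/eqP; rewrite eqn_leq ge andbT; apply: max1.
by right; split=> //; apply: mini; rewrite Pk fk eqxx.
Qed.

Lemma array_sum_jt lambda mu r s : is_partition lambda -> is_partition mu ->
    (forall i, (mu i <= lambda i)%N) -> (forall i, (0 < r i)%N) ->
    flag_compatible lambda mu r -> flag_compatible lambda mu s ->
  array_sum lambda mu r s = jt_const r s * \det (jt_matrix lambda mu r s).
Proof.
(* Induction on the sum of all parts and flags: each recursive call lowers one part or one flag. *)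
move: {2}(_ + _)%N (leqnn (\sum_i lambda i + \sum_i s i)%N) => N.
elim: N lambda s => [|N IH] lambda s leN lP mP ml r0 rP sP.
all: have [/forallP lm|] := boolP [forall i, (lambda i <= mu i)%N].
all: try (have {}lm i : lambda i = mu i by apply/eqP; rewrite eqn_leq lm ml).
all: try by rewrite array_sum_empty // jt_empty.
all: rewrite negb_forall => /existsP[i0]; rewrite -ltnNge => i0P.
  by move: leN; rewrite (bigD1 i0) //=; lia.
have [/existsP[j /andP[jm js]]|] := boolP [exists j, (mu j < lambda j)%N && (s j < r j)%N].
  by rewrite (array_sum_eq0 jm js) (det_jt_eq0 lP mP rP sP jm js) mulr0.
rewrite negb_exists => /forallP rs.
have [i iP imax] := topmost_maximal_row (P := fun i => (mu i < lambda i)%N) s i0P.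
have {}rs j : (mu j < lambda j)%N -> (r j <= s j)%N.
  by move=> jP; have := rs j; rewrite jP /= -leqNgt.
have smax j : (mu j < lambda j)%N -> (s j <= s i)%N.
  by move=> /imax[/ltnW|[-> _]].
have ris := rs i iP; have s0 : (0 < s i)%N by apply: leq_trans ris.
have l0 : (0 < lambda i)%N by apply: leq_ltn_trans iP.
have above k : i = k.+1 :> nat -> (mu k < lambda i)%N -> (s k < s i)%N.
  move=> ik mk; have [|//|[_]] := imax k; last by rewrite ik ltnn.
  by apply: leq_trans mk _; apply: lP; rewrite ik.
have rsi j : (mu j < lambda j)%N -> (r j <= s i)%N.
  by move=> jP; apply: leq_trans (rs j jP) (smax j jP).
have Dpred := det_jt_flag_pred lP mP iP s0 rsi.
have IHs : array_sum lambda mu r (decr s i) =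
    jt_const r (decr s i) * \det (jt_matrix lambda mu r (decr s i)).
  apply: IH => //; first by have := sum_decr s0; lia.
  (* The only inequality at risk is that between row [i] and the row above it, and [above] is
     strict. *)
  move=> k j jk mk; have := sP _ _ jk mk; rewrite /decr.
  case: (eqVneq j i) => [ji|_].
    rewrite ifN; last by rewrite -val_eqE /= -ji jk; lia.
    by move=> _; have := above k; rewrite -ji jk => /(_ erefl mk); lia.
  by case: eqP => [->|_] //; apply: leq_trans (leq_pred _).
have [/existsP[k /andP[/eqP ki /eqP lk]]|] :=
    boolP [exists k : 'I_n, (k == i.+1 :> nat) && (lambda k == lambda i)].
  have mk : (mu k < lambda k)%N.
    by rewrite lk (leq_ltn_trans _ iP) // mP // ki.
  have sk : s k = s i.
    by apply/eqP; rewrite eqn_leq smax //=; apply: sP ki _; rewrite lk.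
  (* With D the determinant, (1 - x alpha) D - x (beta - alpha) D = (1 - beta x) D, the factor by
     which the constants differ. *)
  rewrite (array_sum_flag_pred r mP ki iP lk sk s0) IHs (jt_const_flag_pred ris s0) Dpred.
  rewrite (det_jt_equal_rows mu r ki lk sk l0).
  move: (\det _) (jt_const _ _) (x_ _) (alpha_ _) (beta_ _) => D C x a b; ring.
rewrite negb_exists => /forallP ncor.
have corner k : k = i.+1 :> nat -> (lambda k < lambda i)%N.
  by move=> ki; have := ncor k; rewrite ki eqxx /= ltn_neqAle => -> /=; apply: lP; rewrite ki.
have IHl : array_sum (decr lambda i) mu r s =
    jt_const r s * \det (jt_matrix (decr lambda i) mu r s).
  apply: IH => //.
  - by have := sum_decr l0; lia.
  - move=> k j kj; rewrite /decr; case: (eqVneq j i) => [ji|ji].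
      case: eqP => // /eqP ki; apply: leq_trans (leq_pred _) _.
      by rewrite -ji; apply: lP.
    case: (eqVneq k i) => [ki|_]; last exact: lP.
    (* The shortened row still dominates the later ones, since [corner] makes the next row strictly
       shorter than row [i]. *)
    have ij : (i < j)%N by rewrite ki in kj; rewrite ltn_neqAle kj andbT eq_sym.
    have i1n : (i.+1 < n)%N by apply: leq_ltn_trans (ltn_ord j).
    have := corner (Ordinal i1n) erefl; have := lP (Ordinal i1n) j ij; lia.
  - by move=> k; rewrite /decr; case: eqP => [->|_] //; lia.
  - by move=> k j jk mk; apply: rP => //; apply: leq_trans mk (decr_le _ _ _).
  by move=> k j jk mk; apply: sP => //; apply: leq_trans mk (decr_le _ _ _).
have := array_sum_corner iP corner (r0 i) ris above.
rewrite IHs IHl (jt_const_flag_pred ris s0) Dpred.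
set G := array_sum _ _ _ _ => GE.
apply/eqP; rewrite -subr_eq0; apply/eqP.
(* Both sides satisfy the corner recursion, so their difference is reproduced by multiplication with
   x alpha. *)
apply: (@fixpoint_XM_eq0 _ _ (IndX (s i)) _ (alpha_ (lambda i))).
rewrite -/(x_ (s i)) {1}GE; clearbody G; clear GE.
move: (\det _) (\det _) (jt_const _ _) (x_ _) (alpha_ _) (beta_ _) => D D' C x a b; ring.
Qed.

End JacobiTrudi.

Theorem theorem3p7 (n : nat) (lambda mu r s : 'I_n -> nat)
    (n_gt0 : (0 < n)%N)
    (lambdaP : is_partition lambda) (muP : is_partition mu)
    (mu_sub_lambda : forall i, (mu i <= lambda i)%N)
    (r_gt0 : forall i, (0 < r i)%N) (s_gt0 : forall i, (0 < s i)%N)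
    (flagP : forall i j : 'I_n, j = i.+1 :> nat -> (mu i < lambda j)%N ->
      (r i <= r j)%N /\ (s i <= s j)%N) :
  Grow lambda mu r s =
    (\prod_(i < n) \prod_(r i <= l < (s i).+1) (1 - beta_ i.+1 * x_ l))
    * \det (\matrix_(i < n, j < n)
        h_ominus ((lambda i)%:Z - (mu j)%:Z - i%:Z + j%:Z)
          (X_ (r j) (s i))
          (A_ (lambda i) - A_ (mu j) - B_ i + B_ j.+1)).
Proof.
rewrite Grow_array_sum (array_sum_jt lambdaP muP mu_sub_lambda r_gt0) //.
- by move=> i j ij mu_lt; case: (flagP i j ij mu_lt).
by move=> i j ij mu_lt; case: (flagP i j ij mu_lt).
Qed.
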